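(* There exists a PTAS for problem (iK-cs). That is, for every fixed $\varepsilon\in(0,1)$ there is a polynomial-time algorithm which, given any instance of (iK-cs), returns a feasible solution $(x,y)$ with $\sum_{i=1}^n p_i x_i \ge (1-\varepsilon)\,OPT$, where $OPT$ is the optimal objective value of (iK-cs).
   Context: The single-level improvable knapsack problem with continuous weight improvements (iK-cs): there are $n$ items; item $i$ has profit $p_i\ge 0$, original weight $w_i$, improved weight $w_i^1$ with $0\le w_i^1<w_i$, and improvement cost $c_i>0$. There are a knapsack budget $B\ge 0$ and an improvement budget $C\ge 0$. Put $\overline{w}_i := w_i-w_i^1$ (so $0<\overline{w}_i\le w_i$). All data are rational. The problem is $$\max \sum_{i=1}^n p_i x_i \quad\text{s.t.}\quad \sum_{i=1}^n w_i x_i-\sum_{i=1}^n \overline{w}_i y_i\le B,\quad \sum_{i=1}^n c_i y_i\le C,$$ $$y_i\le x_i,\quad y_i\ge 0,\quad x_i\in\{0,1\}\quad\text{for all } i\in\{1,\ldots,n\}.$$ (The $y_i$ are continuous; $y_i$ is the fraction to which item $i$ is improved.) *)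

(* Defs.v *)
From mathcomp Require Import all_boot all_order all_algebra.
From mathcomp Require Import reals.

Set Implicit Arguments.
Unset Strict Implicit.
Unset Printing Implicit Defensive.

Import Order.TTheory GRing.Theory Num.Theory.
Local Open Scope ring_scope.

(* Polynomial time is measured on a random access machine with integer        *)
(* registers under the logarithmic cost criterion (Aho-Hopcroft-Ullman): an   *)
(* operation is charged the bit lengths of its operands and of the addresses  *)
(* it uses, so that running times are polynomially related to those of Turing *)
(* machines.  Control flow is structured rather than by jumps, and registers  *)
(* are indexed by int, so the negative addresses are ordinary extra storage.  *)

Definition memory := int -> int.

Definition update (m : memory) (a v : int) : memory :=
  fun b => if b == a then v else m b.

Definition bitlen (z : int) : nat := (trunc_log 2 `|z|%N).+1.

Inductive expr :=
| Const of int
| Read of expr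
| Add of expr & expr
| Sub of expr & expr
| Mul of expr & expr
| Div of expr & expr.

Inductive program :=
| Skip
| Write of expr & expr                  (* Write address value *)
| Seq of program & program
| IfPos of expr & program & program
| WhilePos of expr & program.

Fixpoint eval (m : memory) (e : expr) : int :=
  match e with
  | Const z => z
  | Read e1 => m (eval m e1)
  | Add e1 e2 => eval m e1 + eval m e2
  | Sub e1 e2 => eval m e1 - eval m e2
  | Mul e1 e2 => eval m e1 * eval m e2
  | Div e1 e2 => (eval m e1 %/ eval m e2)%Z
  end.

Fixpoint eval_cost (m : memory) (e : expr) : nat :=
  match e with
  | Const z => bitlen z
  | Read e1 => (eval_cost m e1 + bitlen (eval m e1) + bitlen (m (eval m e1)))%N
  | Add e1 e2 | Sub e1 e2 | Mul e1 e2 | Div e1 e2 =>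
      (eval_cost m e1 + eval_cost m e2
       + bitlen (eval m e1) + bitlen (eval m e2))%N
  end.

(* exec p m m' t : started in memory m, p halts in memory m' at total cost t. *)
Inductive exec : program -> memory -> memory -> nat -> Prop :=
| ExecSkip m : exec Skip m m 1
| ExecWrite a e m :
    exec (Write a e) m (update m (eval m a) (eval m e))
      (eval_cost m a + eval_cost m e
       + bitlen (eval m a) + bitlen (eval m e))%N
| ExecSeq p1 p2 m m1 m2 t1 t2 :
    exec p1 m m1 t1 -> exec p2 m1 m2 t2 ->
    exec (Seq p1 p2) m m2 (t1 + t2)%N
| ExecIfTrue e p1 p2 m m' t :
    0 < eval m e -> exec p1 m m' t ->
    exec (IfPos e p1 p2) m m' (eval_cost m e + bitlen (eval m e) + t)%N
| ExecIfFalse e p1 p2 m m' t :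
    eval m e <= 0 -> exec p2 m m' t ->
    exec (IfPos e p1 p2) m m' (eval_cost m e + bitlen (eval m e) + t)%N
| ExecWhileTrue e p m m1 m2 t1 t2 :
    0 < eval m e -> exec p m m1 t1 -> exec (WhilePos e p) m1 m2 t2 ->
    exec (WhilePos e p) m m2 (eval_cost m e + bitlen (eval m e) + t1 + t2)%N
| ExecWhileFalse e p m :
    eval m e <= 0 ->
    exec (WhilePos e p) m m (eval_cost m e + bitlen (eval m e))%N.

Record instance := Instance {
  nitems : nat;
  profit : 'I_nitems -> rat;
  weight : 'I_nitems -> rat;
  improved_weight : 'I_nitems -> rat;
  improvement_cost : 'I_nitems -> rat;
  knapsack_budget : rat;
  improvement_budget : rat;
  profit_ge0 : forall i, 0 <= profit i;
  improved_weight_ge0 : forall i, 0 <= improved_weight i;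
  improved_weight_lt : forall i, improved_weight i < weight i;
  improvement_cost_gt0 : forall i, 0 < improvement_cost i;
  knapsack_budget_ge0 : 0 <= knapsack_budget;
  improvement_budget_ge0 : 0 <= improvement_budget }.

Definition weight_reduction (I : instance) (i : 'I_(nitems I)) : rat :=
  weight i - improved_weight i.

Section Optimization.
Variables (R : realType) (I : instance).
Implicit Types (x : 'I_(nitems I) -> bool) (y : 'I_(nitems I) -> R).

Definition feasible x y : Prop :=
  [/\ \sum_i ratr (weight i) * (x i)%:R
        - \sum_i ratr (weight_reduction i) * y i
        <= ratr (knapsack_budget I) :> R,
      \sum_i ratr (improvement_cost i) * y i
        <= ratr (improvement_budget I) :> R
    & forall i, 0 <= y i <= (x i)%:R].

Definition objective x : R := \sum_i ratr (profit i) * (x i)%:R.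

Definition is_optimal_value (v : R) : Prop :=
  (exists x y, feasible x y /\ objective x = v) /\
  (forall x y, feasible x y -> objective x <= v).

End Optimization.

Definition rat_code (q : rat) : seq int := [:: numq q; denq q].

Definition instance_code (I : instance) : seq int :=
  (nitems I)%:Z :: rat_code (knapsack_budget I)
    ++ rat_code (improvement_budget I)
    ++ flatten [seq rat_code (profit i) ++ rat_code (weight i)
                    ++ rat_code (improved_weight i)
                    ++ rat_code (improvement_cost i)
               | i <- enum 'I_(nitems I)].

Definition input_size (I : instance) : nat :=
  (\sum_(z <- instance_code I) bitlen z)%N.

(* The input occupies registers 0, 1, 2, ...; all other registers hold 0. *)
Definition initial_memory (I : instance) : memory :=
  fun a => if a is Posz k then nth 0 (instance_code I) k else 0.

(* Upon halting, registers 3i, 3i+1 and 3i+2 hold x_i and a numerator and a  *)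
(* positive denominator of y_i; the other registers are irrelevant.          *)
Definition outputs (R : realType) (I : instance) (m : memory)
    (x : 'I_(nitems I) -> bool) (y : 'I_(nitems I) -> R) : Prop :=
  forall i : 'I_(nitems I),
    [/\ m (3 * i)%N%:Z = (x i)%:R,
        0 < m (3 * i + 2)%N%:Z
      & y i = (m (3 * i + 1)%N%:Z)%:~R / (m (3 * i + 2)%N%:Z)%:~R].

(* Main.v *)
Require Import Defs.
From mathcomp Require Import all_boot all_order all_algebra.
From mathcomp Require Import zify ring lra.
From mathcomp Require Import boolp reals.

(** The program guesses a small set G of the most profitable items of an optimal
    solution, bounds the remaining items by a Lagrangian relaxation, and rounds.

    Price a unit of knapsack capacity at lambda and a unit of improvement budget at mu.
    Item i then costs g_i = min (lambda w_i, lambda v_i + mu c_i), where v_i is the fully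
    improved weight, and if S is the set of items that may be added to G, weak duality
    bounds what S contributes by
      D = lambda B + mu C + sum_S max (0, p_i - g_i) - sum_G g_i.
    D is convex, and it is affine on every cell cut out by the lines
    lambda w_i = p_i, lambda v_i + mu c_i = p_i, lambda (w_i - v_i) = mu c_i and the two axes.
    Sliding first along any direction and then along the line that was hit shows that each
    point is dominated by an intersection of two of these lines ([vertex_below]); so D has a
    minimiser z among polynomially many points ([dual_minimiser]).

    At a minimiser two one-sided derivatives suffice.  In a direction d >= 0 the derivative
    says that the items of G together with those of S with p_i > g_i(z) satisfy
    sum g_i(d) <= d_1 B + d_2 C ([minimiser_feasible]); this is the dual form of feasibility,
    and improving greedily by the ratio (w_i - v_i) / c_i turns it into a feasible y
    ([greedy_fits]).  In the direction -z, since every g_i is homogeneous, it says that the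
    items of S with p_i >= g_i(z) are worth at least D(z) ([dual_le_taken]).  So the rounded
    solution loses only the tied items, p_i = g_i(z).  The profits are first perturbed to
    N^n p_i + N^i with N larger than all the 2 x 2 determinants of the weight and cost data:
    three tied items would give a nontrivial linear relation with small coefficients between
    three perturbed profits, which is impossible in base N, so at most two items are tied
    ([card_tied]).  Each of them is worth at most the cheapest item of G, hence at most OPT / k
    when G has k items, and k >= 2 / eps is enough.

    A candidate is thus a number with k + 5 digits in base n + 3: the items of G, two lines and
    the item whose ratio is the threshold of the greedy improvement.  The program evaluates all
    candidates and keeps the most profitable one that passes an exact feasibility test; by the
    analysis above some candidate is good enough.

    For the running time the algorithm is written as an integer function of the input, built
    from arithmetic, comparisons, and sums and products over polynomial ranges.  The functions
    computed by some program in polynomial time are closed under all these operations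
    ([computable_op], [computable_weaken], [computable_iteri]), so no program has to be written
    by hand except for the one that stores the answers ([output_program]). *)

Import Order.TTheory GRing.Theory Num.Theory.
Local Open Scope ring_scope.
Set Implicit Arguments.
Unset Strict Implicit.

(** * Polynomial bounds and bit lengths *)

(** The base L + 2 absorbs constants, since c <= (L + 2) ^ c; a single exponent therefore
    describes a class that is closed under sums and products. *)
Definition poly_bounded (q : nat -> nat) : Prop :=
  exists k, forall L, (q L <= (L + 2) ^ k)%N.

Lemma leq_pow2 L k1 k2 : (k1 <= k2)%N -> ((L + 2) ^ k1 <= (L + 2) ^ k2)%N.
Proof. by move=> h; apply: leq_pexp2l => //; rewrite addn2. Qed.

Lemma poly_bounded_const c : poly_bounded (fun _ => c).
Proof.
exists c => L; apply: leq_trans (ltnW (ltn_expl c (isT : (1 < 2)%N))) _.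
by case: c => // c; rewrite leq_exp2r // addn2.
Qed.

Lemma poly_bounded_id : poly_bounded (fun L => L).
Proof. by exists 1%N => L; rewrite expn1 leq_addr. Qed.

Lemma poly_bounded_pow k : poly_bounded (fun L => ((L + 2) ^ k)%N).
Proof. by exists k. Qed.

Lemma poly_bounded_add q1 q2 : poly_bounded q1 -> poly_bounded q2 ->
  poly_bounded (fun L => (q1 L + q2 L)%N).
Proof.
move=> [k1 h1] [k2 h2]; exists (maxn k1 k2).+1 => L.
have := leq_pow2 L (leq_maxl k1 k2); have := leq_pow2 L (leq_maxr k1 k2).
have := h1 L; have := h2 L; rewrite expnS.
move: ((L + 2) ^ maxn k1 k2)%N => X; nia.
Qed.

Lemma poly_bounded_mul q1 q2 : poly_bounded q1 -> poly_bounded q2 ->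
  poly_bounded (fun L => (q1 L * q2 L)%N).
Proof.
move=> [k1 h1] [k2 h2]; exists (k1 + k2)%N => L.
by rewrite expnD leq_mul.
Qed.

Lemma poly_bounded_exp q k : poly_bounded q -> poly_bounded (fun L => (q L ^ k)%N).
Proof.
move=> [k1 h1]; exists (k1 * k)%N => L; rewrite expnM.
by case: k => // k; rewrite leq_exp2r.
Qed.

Lemma bitlen_gt0 z : (0 < bitlen z)%N. Proof. by []. Qed.

Lemma bitlenP z b : (0 < b)%N -> (bitlen z <= b)%N = (`|z| < 2 ^ b)%N.
Proof.
move=> b0; rewrite /bitlen; case: (posnP `|z|%N) => [->|z0].
  by rewrite trunc_log0 expn_gt0 b0.
apply/idP/idP => h.
  have /andP[_ h2] := trunc_log_bounds (isT : (1 < 2)%N) z0.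
  by apply: leq_trans h2 _; rewrite leq_pexp2l.
rewrite -(ltn_exp2l _ _ (isT : (1 < 2)%N)).
by apply: leq_ltn_trans h; apply: trunc_logP.
Qed.

Lemma ltn_bitlen z : (`|z| < 2 ^ bitlen z)%N.
Proof. by rewrite -bitlenP. Qed.

Lemma bitlen_add a b : (bitlen (a + b) <= bitlen a + bitlen b)%N.
Proof.
rewrite bitlenP ?addn_gt0 // expnD.
have := ltn_bitlen a; have := ltn_bitlen b.
have : (2 <= 2 ^ bitlen a)%N by rewrite -{1}(expn1 2) leq_pexp2l.
have : (2 <= 2 ^ bitlen b)%N by rewrite -{1}(expn1 2) leq_pexp2l.
move: (2 ^ bitlen a)%N (2 ^ bitlen b)%N => X Y; have : (`|(a + b)%R| <= `|a| + `|b|)%N by lia.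
nia.
Qed.

Lemma bitlen_opp a : bitlen (- a) = bitlen a.
Proof. by rewrite /bitlen abszN. Qed.

Lemma bitlen_sub a b : (bitlen (a - b) <= bitlen a + bitlen b)%N.
Proof. by rewrite -(bitlen_opp b) bitlen_add. Qed.

Lemma bitlen_mul a b : (bitlen (a * b) <= bitlen a + bitlen b)%N.
Proof. by rewrite bitlenP // expnD abszM ltn_mul // ltn_bitlen. Qed.

Lemma bitlen_div a b : (bitlen (a %/ b)%Z <= bitlen a + bitlen b)%N.
Proof.
rewrite bitlenP // expnD.
have := ltn_bitlen a; have := lez_div a b.
have : (1 <= 2 ^ bitlen b)%N by rewrite expn_gt0.
nia.
Qed.

Lemma bitlen_nat (k : nat) : (bitlen k <= k.+1)%N.
Proof. by rewrite bitlenP //=; apply: ltn_trans (ltnSn k) (ltn_expl _ _). Qed.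

(** * Programs with cost bounds *)

Lemma update_eq m a v : update m a v a = v.
Proof. by rewrite /update eqxx. Qed.

Lemma update_neq m a v b : b <> a -> update m a v b = m b.
Proof. by move/eqP/negPf; rewrite /update => ->. Qed.

(** A triple with a cost bound: it hides the memories and times between the steps of
    [exec]. *)
Definition runs (p : program) (m : memory) (q : nat) (Q : memory -> Prop) :=
  exists m' t, [/\ exec p m m' t, (t <= q)%N & Q m'].

Lemma runs_le p m q1 q2 Q1 Q2 : (q1 <= q2)%N -> (forall m', Q1 m' -> Q2 m') ->
  runs p m q1 Q1 -> runs p m q2 Q2.
Proof.
move=> h hQ [m' [t [h1 h2 h3]]]; exists m', t; split=> //; last exact: hQ.
exact: leq_trans h2 h.
Qed.

Lemma runs_write a x m q (Q : memory -> Prop) :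
  (eval_cost m a + eval_cost m x + bitlen (eval m a) + bitlen (eval m x) <= q)%N ->
  Q (update m (eval m a) (eval m x)) -> runs (Write a x) m q Q.
Proof.
move=> h hQ; eexists (update m (eval m a) (eval m x)), _.
by split; [exact: ExecWrite | exact: h |].
Qed.

Lemma runs_seq p1 p2 m q1 q2 Q :
  runs p1 m q1 (fun m1 => runs p2 m1 q2 Q) -> runs (Seq p1 p2) m (q1 + q2) Q.
Proof.
move=> [m1 [t1 [h1 b1 [m2 [t2 [h2 b2 hQ]]]]]].
by exists m2, (t1 + t2)%N; split; [exact: ExecSeq h1 h2 | exact: leq_add |].
Qed.

Lemma runs_if x p1 p2 m q1 q2 Q :
  (eval_cost m x + bitlen (eval m x) <= q1)%N ->
  (0 < eval m x -> runs p1 m q2 Q) -> (eval m x <= 0 -> runs p2 m q2 Q) ->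
  runs (IfPos x p1 p2) m (q1 + q2) Q.
Proof.
move=> hc h1 h2; case: (ltP 0 (eval m x)) => hx.
  have [m' [t [he ht hQ]]] := h1 hx.
  by exists m', (eval_cost m x + bitlen (eval m x) + t)%N; split;
    [exact: ExecIfTrue | exact: leq_add|].
have [m' [t [he ht hQ]]] := h2 hx.
by exists m', (eval_cost m x + bitlen (eval m x) + t)%N; split;
  [exact: ExecIfFalse | exact: leq_add|].
Qed.

(** A round costs at most q for the guard and q for the body; the failing last test accounts
    for the successor of N. *)
Lemma runs_for (N : nat) x body m q (Inv : nat -> memory -> Prop) :
  (forall j m1, (j <= N)%N -> Inv j m1 ->
     eval m1 x = (N - j)%N /\ (eval_cost m1 x + bitlen (eval m1 x) <= q)%N) ->
  (forall j m1, (j < N)%N -> Inv j m1 -> runs body m1 q (Inv j.+1)) ->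
  Inv 0%N m -> runs (WhilePos x body) m (N.+1 * (q + q)) (Inv N).
Proof.
move=> hx hbody h0.
suff gen r j m1 : (j + r = N)%N -> Inv j m1 ->
    runs (WhilePos x body) m1 (r.+1 * (q + q)) (Inv N) by apply: (gen N 0%N).
elim: r j m1 => [|r IH] j m1 hj hI.
  rewrite addn0 in hj; subst j; have [e1 c1] := hx _ _ (leqnn _) hI.
  exists m1, (eval_cost m1 x + bitlen (eval m1 x))%N; split=> //; last by lia.
  by apply: ExecWhileFalse; rewrite e1 subnn.
have jN : (j < N)%N by lia.
have [e1 c1] := hx _ _ (ltnW jN) hI.
have [m2 [t2 [h2 b2 I2]]] := hbody _ _ jN hI.
have [|m3 [t3 [h3 b3 I3]]] := IH j.+1 m2 _ I2; first by lia.
exists m3, (eval_cost m1 x + bitlen (eval m1 x) + t2 + t3)%N; split => //.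
  by apply: ExecWhileTrue h2 h3; rewrite e1; lia.
by move: b3 c1 b2; rewrite (mulSn r.+1); lia.
Qed.

(** * Functions computable in polynomial time *)

Definition code (I : instance) (j : nat) : int := nth 0 (instance_code I) j.

(** Loop variables live at the negative addresses. The innermost one is the head of the list
    and occupies the register with the highest index, so that entering a loop moves
    nothing. *)
Fixpoint env_loaded (m : memory) (e : seq nat) : Prop :=
  if e is i :: e' then m (Negz (size e')) = i%:Z /\ env_loaded m e' else True.

Definition loaded (I : instance) (e : seq nat) (m : memory) : Prop :=
  (forall j : nat, m (Posz j) = code I j) /\ env_loaded m e.

(** A program may use a window of h registers as scratch space. Everything else must survive:
    the input, the outer loop variables, and what a caller has parked beyond the window. *)
Definition frame (l h : nat) (m m' : memory) : Prop :=
  forall z, (if z is Negz k then (k < l) || (l + h <= k) else true)%N -> m' z = m z.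

Lemma frame_trans l h m1 m2 m3 : frame l h m1 m2 -> frame l h m2 m3 -> frame l h m1 m3.
Proof. by move=> h1 h2 z hz; rewrite h2 // h1. Qed.

Lemma frame_sub l h l' h' m1 m2 : (l' <= l)%N -> (l + h <= l' + h')%N ->
  frame l h m1 m2 -> frame l' h' m1 m2.
Proof. by move=> h1 h2 hf z hz; apply: hf; case: z hz => // k; lia. Qed.

Lemma frame_update l h m k v : (l <= k < l + h)%N -> frame l h m (update m (Negz k) v).
Proof.
move=> hk z hz; apply: update_neq => ez; rewrite ez in hz; lia.
Qed.

Lemma frame_reg l h m m' k : frame l h m m' -> (k < l)%N || (l + h <= k)%N ->
  m' (Negz k) = m (Negz k).
Proof. by move=> hf hk; apply: hf. Qed.

Lemma loaded_frame I e l h m m' : (size e <= l)%N -> frame l h m m' ->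
  loaded I e m -> loaded I e m'.
Proof.
move=> hs hf [hi he]; split=> [j|]; first by rewrite hf.
elim: e hs he => [|i e IH] //= hs [h1 h2]; split; last by apply: IH => //; lia.
by rewrite (frame_reg hf) //; lia.
Qed.

(** The environment entries are bounded by L in value, not in bit length, because they are
    counters of loops of polynomial length. Bounding the bit length of the result by the same
    q as the cost is what makes the class closed under composition. *)
Definition computable_within (l : nat) (f : instance -> seq nat -> int)
    (p : program) (h : nat) (q : nat -> nat) : Prop :=
  forall I e L, size e = l -> (input_size I <= L)%N -> all (fun v => v <= L)%N e ->
  (bitlen (f I e) <= q L)%N /\
  forall m, loaded I e m ->
    runs p m (q L) (fun m' => m' (Negz l) = f I e /\ frame l h m m').

Definition computable (l : nat) (f : instance -> seq nat -> int) : Prop :=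
  exists p h k, computable_within l f p h (fun L => ((L + 2) ^ k)%N).

Lemma computable_intro l f p h q : poly_bounded q ->
  computable_within l f p h q -> computable l f.
Proof.
move=> [k hk] hc; exists p, h, k => I e L h1 h2 h3; have [b c] := hc I e L h1 h2 h3.
split; first exact: leq_trans b (hk L).
by move=> m hm; apply: runs_le (c m hm).
Qed.

Lemma computable_ext l f g : (forall I e, size e = l -> f I e = g I e) ->
  computable l f -> computable l g.
Proof.
move=> hfg [p [h [k hc]]]; exists p, h, k => I e L h1 h2 h3.
by rewrite -hfg //; apply: hc.
Qed.

Notation rd k := (Read (Const (Negz k))).
Notation wr k x := (Write (Const (Negz k)) x).

Definition arithmetic (E : expr -> expr -> expr) (op : int -> int -> int) : Prop :=
  [/\ forall m a b, eval m (E a b) = op (eval m a) (eval m b),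
      forall m a b, eval_cost m (E a b) =
        (eval_cost m a + eval_cost m b + bitlen (eval m a) + bitlen (eval m b))%N
    & forall x y, (bitlen (op x y) <= bitlen x + bitlen y)%N].

Ltac poly := repeat first
  [ apply: poly_bounded_add | apply: poly_bounded_mul
  | exact: poly_bounded_pow | exact: poly_bounded_id | exact: poly_bounded_const
  | apply: poly_bounded_exp ].

(** The value of g is parked above both windows while f is evaluated. *)
Lemma computable_op E op l f g : arithmetic E op -> computable l f -> computable l g ->
  computable l (fun I e => op (f I e) (g I e)).
Proof.
move=> [Ev Ec Eb] [pf [hf [kf cf]]] [pg [hg [kg cg]]].
set h := (maxn (maxn hf hg) 1); set s := (l + h)%N.
pose b := (bitlen (Negz s) + bitlen (Negz l))%N.
apply: (@computable_intro _ _
  (Seq pg (Seq (wr s (rd l)) (Seq pf (wr l (E (rd l) (rd s))))))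
  h.+1 (fun L => (L+2)^kg + ((6 * b + 2 * (L+2)^kg) + ((L+2)^kf + (6 * b + 4 * ((L+2)^kg +
    (L+2)^kf)))))%N).
  by poly.
move=> I e L h1 h2 h3; have [bf rf] := cf I e L h1 h2 h3; have [bg rg] := cg I e L h1 h2 h3.
split; first by apply: leq_trans (Eb _ _) _; lia.
move=> m hm; apply: runs_seq; apply: runs_le (rg m hm) => // m1 [v1 fr1].
have {}fr1 : frame l h.+1 m m1 by apply: frame_sub fr1; rewrite ?leqnn //; lia.
apply: runs_seq; apply: runs_write; first by rewrite /= v1 /b; lia.
rewrite /= v1; set m2 := update _ _ _.
have fr2 : frame l h.+1 m m2.
  by apply: frame_trans fr1 _; apply: frame_update; rewrite /s; lia.
have hm2 : loaded I e m2 by apply: loaded_frame hm; [|exact: fr2]; rewrite h1.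
apply: runs_seq; apply: runs_le (rf m2 hm2) => // m3 [v3 fr3].
have e3 : m3 (Negz s) = g I e.
  by rewrite (frame_reg fr3) ?/m2 ?update_eq //; rewrite /s /h; lia.
have {}fr3 : frame l h.+1 m2 m3 by apply: frame_sub fr3; rewrite ?leqnn //; lia.
apply: runs_write.
  by rewrite /= Ec Ev /= v3 e3; have := Eb (f I e) (g I e); rewrite /b; lia.
rewrite /= Ev /= v3 e3; split; first by rewrite update_eq.
by apply: frame_trans fr2 (frame_trans fr3 _); apply: frame_update; rewrite /h; lia.
Qed.

Lemma computable_add l f g : computable l f -> computable l g ->
  computable l (fun I e => f I e + g I e).
Proof. by apply: (@computable_op Add +%R); split=> //; exact: bitlen_add. Qed.

Lemma computable_sub l f g : computable l f -> computable l g ->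
  computable l (fun I e => f I e - g I e).
Proof.
have sub_arith : arithmetic Defs.Sub (fun x y => x - y) by split=> //; exact: bitlen_sub.
exact: computable_op sub_arith.
Qed.

Lemma computable_mul l f g : computable l f -> computable l g ->
  computable l (fun I e => f I e * g I e).
Proof. by apply: (@computable_op Mul *%R); split=> //; exact: bitlen_mul. Qed.

Lemma computable_div l f g : computable l f -> computable l g ->
  computable l (fun I e => (f I e %/ g I e)%Z).
Proof. by apply: (@computable_op Div divz); split=> //; exact: bitlen_div. Qed.

Lemma computable_const l z : computable l (fun _ _ => z).
Proof.
apply: (@computable_intro _ _ (wr l (Const z)) 1
  (fun _ => bitlen (Negz l) + bitlen (Negz l) + bitlen z + bitlen z)%N); first by poly.
move=> I e L h1 h2 h3; split; first by lia.
move=> m hm; apply: runs_write => /=; first by lia.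
by split; [rewrite update_eq | apply: frame_update; lia].
Qed.

Lemma computable_head l : computable l.+1 (fun _ e => (head 0%N e)%:Z).
Proof.
apply: (@computable_intro _ _ (wr l.+1 (rd l)) 1
  (fun L => 2 * bitlen (Negz l.+1) + 2 * bitlen (Negz l) + 2 * (L + 2))%N); first by poly.
move=> I [|i e] //= L [h1] h2 /andP[h3 _].
have bi := bitlen_nat i.
split; first by lia.
move=> m [_ [hi _]]; rewrite h1 in hi; apply: runs_write => /=; rewrite hi; first by lia.
by split; [rewrite update_eq | apply: frame_update; lia].
Qed.

(** The program for f treats the register of the new loop variable as scratch space, so the
    variable is parked during the run and restored afterwards. *)
Lemma computable_weaken l f : computable l f -> computable l.+1 (fun I e => f I (behead e)).
Proof.
move=> [p [h [k c]]]; set s := (l.+2 + h)%N.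
pose b := (bitlen (Negz s) + bitlen (Negz l) + bitlen (Negz l.+1))%N.
apply: (@computable_intro _ _
  (Seq (wr s (rd l)) (Seq p (Seq (wr l.+1 (rd l)) (wr l (rd s)))))
  h.+2 (fun L => (2 * (b + b + (L+2))) + ((L+2)^k + (2 * (b + b + (L+2)^k) + 2 * (b + b +
    (L+2)))))%N).
  by poly.
move=> I [|i e] //= L [h1] h2 /andP[h3 h4]; have [bf rf] := c I e L h1 h2 h4.
have bi := bitlen_nat i.
split; first by lia.
move=> m [hI [hi he]]; rewrite h1 in hi.
apply: runs_seq; apply: runs_write => /=; first by rewrite hi /b; lia.
rewrite hi; set m1 := update _ _ _.
have fr1 : frame l.+1 h.+2 m m1 by apply: frame_update; rewrite /s; lia.
have hm1 : loaded I e m1.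
  by apply: (loaded_frame _ fr1) => //; lia.
have e1 : m1 (Negz s) = i by rewrite /m1 update_eq.
apply: runs_seq; apply: runs_le (rf _ hm1) => // m2 [v2 fr2].
have e2 : m2 (Negz s) = i by rewrite (frame_reg fr2) // /s; lia.
apply: runs_seq; apply: runs_write => /=; first by rewrite v2 /b; lia.
apply: runs_write => /=.
  by rewrite update_neq ?e2 /b; [lia | case; rewrite /s; lia].
rewrite v2 [update _ _ _ (Negz s)]update_neq ?e2; last by case; rewrite /s; lia.
split; first by rewrite update_neq ?update_eq //; case; lia.
move=> z hz; have [->|/eqP zl] := eqVneq z (Negz l).
  by rewrite update_eq hi.
rewrite !update_neq //; last by move=> ez; rewrite ez in hz; lia.
rewrite fr2; last first.
  case: z hz zl => // j hj hl; have [ej|] := eqVneq j l; [by rewrite ej in hl | lia].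
by apply: fr1.
Qed.

Lemma code_bitlen I j : (bitlen (code I j) <= input_size I)%N.
Proof.
rewrite /code /input_size; case: (ltnP j (size (instance_code I))) => hj.
  by rewrite (big_rem (nth 0 (instance_code I) j)) ?mem_nth //= leq_addr.
by rewrite nth_default // /instance_code big_cons; case: (bitlen _) (bitlen_gt0 (nitems I)).
Qed.

Lemma computable_code l f : computable l (fun I e => (f I e : nat)%:Z) ->
  computable l (fun I e => code I (f I e)).
Proof.
move=> [p [h [k c]]].
apply: (@computable_intro _ _ (Seq p (wr l (Read (rd l)))) h.+1
  (fun L => (L+2)^k + (4 * bitlen (Negz l) + 2 * (L+2)^k + 2 * L))%N).
  by poly.
move=> I e L h1 h2 h3; have [bf rf] := c I e L h1 h2 h3.
have bc := code_bitlen I (f I e).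
split; first by lia.
move=> m hm; apply: runs_seq; apply: runs_le (rf m hm) => // m1 [v1 fr1].
have e1 : m1 (Posz (f I e)) = code I (f I e) by rewrite fr1 //; case: hm.
apply: runs_write; rewrite /= v1 e1; first by lia.
split; first by rewrite update_eq.
apply: frame_trans (frame_sub _ _ fr1) _; rewrite ?leqnn //; first by lia.
by apply: frame_update; lia.
Qed.

Lemma computable_pos l f : computable l f ->
  computable l (fun I e => ((0 < f I e)%R : nat)%:Z).
Proof.
move=> [p [h [k c]]].
apply: (@computable_intro _ _ (Seq p (IfPos (rd l) (wr l (Const 1)) (wr l (Const 0)))) h.+1
  (fun L => (L+2)^k + ((2 * bitlen (Negz l) + 2 * (L+2)^k) + (2 * bitlen (Negz l) + 4)))%N).
  by poly.
move=> I e L h1 h2 h3; have [bf rf] := c I e L h1 h2 h3.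
have b2 := bitlen_nat (0 < f I e)%R.
split; first by have := leq_b1 (0 < f I e)%R; lia.
move=> m hm; apply: runs_seq; apply: runs_le (rf m hm) => // m1 [v1 fr1].
have {}fr1 : frame l h.+1 m m1 by apply: frame_sub fr1; rewrite ?leqnn //; lia.
have b0 : bitlen 0 = 1%N by []. have b1 : bitlen 1 = 1%N by [].
apply: runs_if => /=; rewrite v1; first by lia.
  move=> ->; apply: runs_write => /=; first by lia.
  by split; [rewrite update_eq | apply: frame_trans fr1 _; apply: frame_update; lia].
move=> /le_gtF ->; apply: runs_write => /=; first by lia.
by split; [rewrite update_eq | apply: frame_trans fr1 _; apply: frame_update; lia].
Qed.

(** * Bounded iteration and output *)

Lemma size_instance_code I : size (instance_code I) = (5 + 8 * nitems I)%N.
Proof.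
rewrite /instance_code /= size_flatten /shape -map_comp sumnE big_map.
rewrite (eq_bigr (fun=> 8%N)); last by move=> i _; rewrite /= /rat_code.
by rewrite big_const_seq count_predT size_enum_ord iter_addn_0.
Qed.

Lemma nitems_le_input_size I : (nitems I <= input_size I)%N.
Proof.
apply: (@leq_trans (size (instance_code I))); first by rewrite size_instance_code; lia.
rewrite /input_size -sum1_size; apply: leq_sum => z _; exact: bitlen_gt0.
Qed.

(** Loop bounds have the form (u n + b) ^ k, so that the number of rounds is polynomial by
    construction and constant ranges (u = 0) are included. *)
Fixpoint bound_expr (u b k : nat) : expr :=
  if k is k'.+1 then
    Mul (Add (Mul (Const u) (Read (Const 0))) (Const b)) (bound_expr u b k')
  else Const 1.

Lemma bound_exprE u b k m n : m 0 = n%:Z ->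
  eval m (bound_expr u b k) = ((u * n + b) ^ k)%N.
Proof.
by move=> h; elim: k => //= k ->; rewrite h expnS; lia.
Qed.

Lemma bound_expr_cost u b k m n L : m 0 = n%:Z -> (n <= L)%N ->
  (eval_cost m (bound_expr u b k)
     <= 1 + k * (3 * bitlen u + 2 * bitlen b + 8 * (u * L + b + L + 2) ^ k.+1))%N.
Proof.
move=> h hn; suff gen j : (j <= k)%N ->
  (eval_cost m (bound_expr u b j) <=
    1 + j * (3 * bitlen u + 2 * bitlen b + 8 * (u * L + b + L + 2) ^ k.+1))%N by exact: gen.
elim: j => // j IH hj.
have e1 := bound_exprE u b j h; rewrite /= h e1.
have {IH} := IH (ltnW hj); rewrite [in X in _ -> X]mulSn.
have ->: u%:Z * n%:Z = (u * n)%N by lia.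
have ->: (u * n)%N%:Z + b%:Z = (u * n + b)%N by lia.
have b1 := bitlen_nat n; have b2 := bitlen_nat (u * n)%N.
have b3 := bitlen_nat (u * n + b)%N; have b4 := bitlen_nat ((u * n + b) ^ j)%N.
have b0 : bitlen 0 = 1%N by [].
have hu : (u * n <= u * L)%N by rewrite leq_mul2l hn orbT.
have hX : (u * L + b + L + 2 <= (u * L + b + L + 2) ^ k.+1)%N.
  by rewrite -[X in (X <= _)%N]expn1 leq_pexp2l ?addn2.
have hY : ((u * n + b) ^ j <= (u * L + b + L + 2) ^ k.+1)%N.
  apply: (@leq_trans ((u * L + b + L + 2) ^ j)%N).
    by case: (j) => // j'; rewrite leq_exp2r //; lia.
  by rewrite leq_pexp2l ?addn2 //; lia.
rewrite b0; move: ((u * L + b + L + 2) ^ k.+1)%N ((u * n + b) ^ j)%N hX hY b4 => X Y.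
move: (eval_cost _ _) => c; move: (j * _)%N => d; lia.
Qed.

(** In each round the bit length of the accumulator grows by at most that of one term, for
    sums and products alike; repeated squaring cannot be expressed because the terms do not
    depend on the accumulator. *)
Lemma computable_iteri u b k E op z0 l F : arithmetic E op ->
  computable l.+1 (fun I e => F I (behead e) (head 0%N e)) ->
  computable l (fun I e =>
    iteri ((u * nitems I + b) ^ k) (fun i acc => op acc (F I e i)) z0).
Proof.
move=> [Ev Ec Eb] [pf [h [kf cf]]].
pose H := (h + 2)%N; pose s := (l + H)%N.
pose Y := fun L => ((u * L + b + L + 2) ^ k.+1)%N.
pose V := fun L => ((L + Y L + 2) ^ kf)%N.
pose W := fun L => (bitlen z0 + Y L * V L)%N.
pose c0 := (bitlen (Negz s) + bitlen (Negz l) + bitlen (Negz l.+1) + 2)%N.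
pose cB := fun L => (1 + k * (3 * bitlen u + 2 * bitlen b + 8 * (u * L + b + L + 2) ^ k.+1))%N.
pose q := fun L => (cB L + 8 * c0 + 8 * W L + 8 * V L + 8 * (Y L + 2))%N.
apply: (@computable_intro _ _
  (Seq (wr l (Const 0)) (Seq (wr s (Const z0)) (Seq
     (WhilePos (Defs.Sub (bound_expr u b k) (rd l))
        (Seq pf (Seq (wr s (E (rd s) (rd l.+1))) (wr l (Add (rd l) (Const 1))))))
     (wr l (rd s))))) H.+1
  (fun L => q L + (q L + ((Y L).+1 * (q L + q L) + q L)))%N).
  have pY : poly_bounded Y by rewrite /Y; poly.
  have pV : poly_bounded V by rewrite /V; poly.
  have pW : poly_bounded W by rewrite /W; poly.
  have pq : poly_bounded q by rewrite /q /cB; poly.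
  have pY1 : poly_bounded (fun L => (Y L).+1).
    have [k1 h1] : poly_bounded (fun L => (1 + Y L)%N) by poly.
    by exists k1 => L; exact: h1.
  by poly.
move=> I e L h1 h2 h3; set N := (_ ^ k)%N.
have nL : (nitems I <= L)%N := leq_trans (nitems_le_input_size I) h2.
have NY : (N <= Y L)%N.
  apply: (@leq_trans ((u * L + b + L + 2) ^ k)%N).
    rewrite /N; case: (k) => // k'; rewrite leq_exp2r //.
    by have := leq_mul (leqnn u) nL; lia.
  by rewrite leq_pexp2l ?addn2 //; lia.
have bz j : (j <= N)%N -> (bitlen (Posz j) <= Y L + 2)%N.
  by move=> hj; have := bitlen_nat j; lia.
have hF j : (j < N)%N -> (bitlen (F I e j) <= V L)%N /\
    forall m, loaded I (j :: e) m -> runs pf m (V L)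
      (fun m' => m' (Negz l.+1) = F I e j /\ frame l.+1 h m m').
  move=> hj; apply: (cf I (j :: e) (L + Y L)%N) => /=; first by rewrite h1.
    by lia.
  apply/andP; split; first by lia.
  by apply: sub_all h3 => v; lia.
set acc := fun j => iteri j (fun i a => op a (F I e i)) z0.
have hacc j : (j <= N)%N -> (bitlen (acc j) <= bitlen z0 + j * V L)%N.
  elim: j => [|j IH] hj /=; first by lia.
  have := Eb (acc j) (F I e j); have [+ _] := hF j hj; have := IH (ltnW hj).
  by rewrite mulSn; lia.
have hW j : (j <= N)%N -> (bitlen (acc j) <= W L)%N.
  move=> hj; apply: leq_trans (hacc j hj) _.
  by rewrite /W leq_add2l leq_mul2r (leq_trans hj NY) orbT.
split; first by apply: leq_trans (hW N (leqnn _)) _; rewrite /q; lia.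
move=> m hm.
have cBb (m1 : memory) : m1 0 = (nitems I)%:Z -> (eval_cost m1 (bound_expr u b k) <= cB L)%N.
  by move=> e0; apply: bound_expr_cost e0 nL.
have b01 : bitlen 0 = 1%N by []. have b11 : bitlen 1 = 1%N by [].
have bz0 : (bitlen z0 <= W L)%N by rewrite /W leq_addr.
apply: runs_seq; apply: runs_write => /=; first by rewrite /q /c0; lia.
apply: runs_seq; apply: runs_write => /=; first by rewrite /q /c0; lia.
set m1 := update (update m _ _) _ _.
pose Inv (j : nat) (m2 : memory) := [/\ frame l H.+1 m m2, m2 (Negz l) = j & m2 (Negz s) = acc j].
have I0 : Inv 0%N m1.
  split.
  - by apply: frame_trans (frame_update _ _ _) (frame_update _ _ _); rewrite /s /H; lia.
  - by rewrite /m1 update_neq ?update_eq //; case; rewrite /s /H; lia.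
  - by rewrite /m1 update_eq.
apply: runs_seq.
have m0 (m2 : memory) : frame l H.+1 m m2 -> m2 0 = (nitems I)%:Z.
  by move=> fr; rewrite fr //; case: hm => -> _.
apply: runs_le (runs_for (N := N) (Inv := Inv) (q := q L) _ _ I0).
- by rewrite leq_mul2r ltnS NY orbT.
- move=> m2 [fr vl vs]; apply: runs_write => /=; rewrite vs.
    by have := hW N (leqnn _); rewrite /q /c0; lia.
  split; first by rewrite update_eq.
  by apply: frame_trans fr (frame_update _ _ _); lia.
- move=> j m2 hj [fr vl vs] /=; rewrite (bound_exprE _ _ _ (m0 _ fr)) vl -/N.
  split; first by lia.
  have -> : N%:Z - j%:Z = (N - j)%N by lia.
  have := bz j hj; have := bz N (leqnn _); have := bz (N - j)%N (leq_subr _ _).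
  by have := cBb m2 (m0 _ fr); rewrite /q /c0; lia.
move=> j m2 hj [fr vl vs]; have [bF rF] := hF j hj.
have hl : loaded I (j :: e) m2.
  have [hI he] : loaded I e m2 by apply: (loaded_frame _ fr) => //; rewrite h1.
  by split=> //=; split=> //; rewrite h1.
apply: (@runs_le _ _ (V L + (4 * c0 + 3 * W L + 3 * V L + (4 * c0 + 3 * (Y L + 2))))%N _
  (Inv j.+1)) => //; first by rewrite /q; lia.
apply: runs_seq; apply: runs_le (rF m2 hl) => // m3 [v3 fr3].
have vs3 : m3 (Negz s) = acc j by rewrite (frame_reg fr3) // /s /H; lia.
have vl3 : m3 (Negz l) = j by rewrite (frame_reg fr3) //; lia.
have {}fr3 : frame l H.+1 m m3.
  by apply: frame_trans fr (frame_sub _ _ fr3); rewrite /H; lia.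
apply: runs_seq; apply: runs_write => /=; rewrite ?Ec ?Ev /= vs3 v3.
  have := hW j.+1 hj; have := hW j (ltnW hj); rewrite /= -/(acc j) /c0; lia.
set m4 := update _ _ _.
have vl4 : m4 (Negz l) = j by rewrite /m4 update_neq ?vl3 //; case; rewrite /s /H; lia.
apply: runs_write => /=; rewrite vl4.
  have := bz j (ltnW hj); have := bz j.+1 hj; rewrite b11 /c0.
  by rewrite (_ : j%:Z + 1 = j.+1%:Z); lia.
split.
- by apply: frame_trans fr3 (frame_trans (frame_update _ _ _) (frame_update _ _ _));
  rewrite /s /H; lia.
- by rewrite update_eq; lia.
- by rewrite update_neq ?/m4 ?update_eq //; case; rewrite /s /H; lia.
Qed.

Lemma computable_sum u b k l (N : instance -> nat) F :
  (forall I, N I = ((u * nitems I + b) ^ k)%N) ->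
  computable l.+1 (fun I e => F I (behead e) (head 0%N e)) ->
  computable l (fun I e => \sum_(i < N I) F I e i).
Proof.
move=> hN hF; have arith : arithmetic Add +%R by split=> //; exact: bitlen_add.
apply: computable_ext (computable_iteri u b k 0 arith hF) => I e _; rewrite -hN.
by elim: (N I) => [|j IH]; rewrite ?big_ord0 // big_ord_recr /= IH.
Qed.

Lemma computable_prod u b k l (N : instance -> nat) F :
  (forall I, N I = ((u * nitems I + b) ^ k)%N) ->
  computable l.+1 (fun I e => F I (behead e) (head 0%N e)) ->
  computable l (fun I e => \prod_(i < N I) F I e i).
Proof.
move=> hN hF; have arith : arithmetic Mul *%R by split=> //; exact: bitlen_mul.
apply: computable_ext (computable_iteri u b k 1 arith hF) => I e _; rewrite -hN.
by elim: (N I) => [|j IH]; rewrite ?big_ord0 // big_ord_recr /= IH.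
Qed.

(** The answers overlap the registers of the input, which is needed until the last answer is
    known. They are therefore collected in a buffer below the scratch registers and copied to
    their place by a second loop. *)
Lemma output_program (f : instance -> nat -> int) :
  computable 1 (fun I e => f I (head 0%N e)) ->
  exists prog c d, forall I, exists m t,
    [/\ exec prog (initial_memory I) m t, (t <= c * input_size I ^ d)%N
      & forall j, (j < 3 * nitems I)%N -> m (Posz j) = f I j].
Proof.
move=> [p [h [k cp]]].
pose H := (h + 2)%N; pose s := H.+1.
(* The number of answers is saved in Negz H, as register 0 is going to be overwritten; the
   counter j of both loops is Negz 0, and the j-th cell of the buffer is Negz (s + j). *)
pose cnt := Mul (Const 3) (Read (Const 0)).
pose cell := Defs.Sub (Const (Negz s)) (rd 0).
pose incr := wr 0 (Add (rd 0) (Const 1)).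
pose prog := Seq (wr H cnt) (Seq (wr 0 (Const 0)) (Seq
  (WhilePos (Defs.Sub (rd H) (rd 0)) (Seq p (Seq (Write cell (rd 1)) incr)))
  (Seq (wr 0 (Const 0))
    (WhilePos (Defs.Sub (rd H) (rd 0)) (Seq (Write (rd 0) (Read cell)) incr))))).
pose c0 := (bitlen (Negz H) + bitlen (Negz s) + bitlen (Negz 0) + bitlen (Negz 1) + bitlen 3 + 2)%N.
pose V := fun L => ((L + 3 * L + 2) ^ k)%N.
pose q := fun L => (10 * c0 + 10 * V L + 10 * (3 * L + s + 2))%N.
pose Q := fun L => (q L + (q L + ((3 * L).+1 * (q L + q L) + (q L + (3 * L).+1 * (q L + q L)))))%N.
have [K hK] : poly_bounded Q.
  have pV : poly_bounded V by rewrite /V; poly.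
  have pq : poly_bounded q by rewrite /q; poly.
  have pL : poly_bounded (fun L => (3 * L).+1).
    have [k1 h1] : poly_bounded (fun L => (1 + 3 * L)%N) by poly.
    by exists k1 => L; exact: h1.
  by rewrite /Q; poly.
exists prog, (3 ^ K)%N, K => I.
set L := input_size I; set n := nitems I; set N := (3 * n)%N.
have nL : (n <= L)%N := nitems_le_input_size I.
suff [m [t [h1 h2 h3]]] : runs prog (initial_memory I) (Q L)
    (fun m => forall j, (j < N)%N -> m (Posz j) = f I j).
  exists m, t; split=> //; apply: leq_trans h2 (leq_trans (hK L) _).
  have L0 : (0 < L)%N.
    by rewrite /L /input_size /instance_code big_cons; case: (bitlen _) (bitlen_gt0 (nitems I)).
  by rewrite -expnMn; case: (K) => // K'; rewrite leq_exp2r //; lia.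
have bz j : (j <= N)%N -> (bitlen (Posz j) <= 3 * L + s + 2)%N.
  by move=> hj; have := bitlen_nat j; rewrite /N in hj; lia.
have bc j : (j <= N)%N -> (bitlen (Negz (s + j)) <= 3 * L + s + 2)%N.
  move=> hj; rewrite NegzE bitlen_opp; have := bitlen_nat (s + j).+1.
  by rewrite /N in hj; lia.
have b01 : bitlen 0 = 1%N by []. have b11 : bitlen 1 = 1%N by [].
have cellE j : Negz s - Posz j = Negz (s + j) by rewrite !NegzE; lia.
have hp j : (j < N)%N -> (bitlen (f I j) <= V L)%N /\
    forall m, loaded I [:: j] m -> runs p m (V L)
      (fun m' => m' (Negz 1) = f I j /\ frame 1 h m m').
  move=> hj; apply: (cp I [:: j] (L + 3 * L)%N) => //=; first by lia.
  by rewrite andbT; rewrite /N in hj; lia.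
rewrite /Q; set m0 := initial_memory I.
have m0E j : m0 (Posz j) = code I j by [].
have m00 : m0 0 = n by rewrite m0E.
clearbody m0.
apply: runs_seq; apply: runs_write => /=; rewrite m00.
  have -> : 3 * n%:Z = N%:Z by rewrite /N; lia.
  have := bz N (leqnn _); have := bz n; rewrite /q /c0 b01 /N; lia.
have -> : 3 * n%:Z = N%:Z by rewrite /N; lia.
set m1 := update _ _ _.
apply: runs_seq; apply: runs_write => /=; first by rewrite /q /c0; lia.
set m2 := update _ _ _.
have e2H : m2 (Negz H) = N by rewrite /m2 update_neq ?/m1 ?update_eq //; case; rewrite /H; lia.
apply: runs_seq.
pose Inv (j : nat) (m : memory) :=
  [/\ forall i : nat, m (Posz i) = code I i, m (Negz 0) = j, m (Negz H) = N
  & forall i, (i < j)%N -> m (Negz (s + i)) = f I i].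
have guard (j : nat) (m : memory) : (j <= N)%N -> m (Negz 0) = j -> m (Negz H) = N ->
   eval m (Defs.Sub (rd H) (rd 0)) = (N - j)%N /\
   (eval_cost m (Defs.Sub (rd H) (rd 0)) + bitlen (eval m (Defs.Sub (rd H) (rd 0))) <= q L)%N.
  move=> hj ej eN /=; rewrite ej eN; split; first by lia.
  have -> : N%:Z - j%:Z = (N - j)%N by lia.
  by have := bz N (leqnn _); have := bz j hj; have := bz _ (leq_subr j N); rewrite /q /c0; lia.
have I2 : Inv 0%N m2 by split.
apply: runs_le (runs_for (N := N) (Inv := Inv) (q := q L) _ _ I2).
- by rewrite leq_mul2r ltnS leq_mul2l nL !orbT.
- move=> m3 [i3 z3 H3 o3].
  apply: runs_seq; apply: runs_write => /=; first by rewrite /q /c0; lia.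
  set m4 := update _ _ _.
  pose Inv' (j : nat) (m : memory) := [/\ m (Negz 0) = j, m (Negz H) = N,
    forall i, (i < N)%N -> m (Negz (s + i)) = f I i &
    forall i, (i < j)%N -> m (Posz i) = f I i].
  have I4 : Inv' 0%N m4.
    split.
    + by rewrite /m4 update_eq.
    + by rewrite /m4 update_neq //; case; rewrite /H; lia.
    + by move=> i hi; rewrite /m4 update_neq ?o3 //; case; rewrite /s; lia.
    + by [].
  apply: runs_le (runs_for (N := N) (Inv := Inv') (q := q L) _ _ I4).
  + by rewrite leq_mul2r ltnS leq_mul2l nL !orbT.
  + by move=> m5 [_ _ _].
  + by move=> j m5 hj [z5 H5 o5 r5]; apply: guard.
  move=> j m5 hj [z5 H5 o5 r5].
  have [bf _] := hp j hj.
  apply: (@runs_le _ _ ((5 * c0 + 5 * V L + 5 * (3 * L + s + 2)) + (5 * c0 + 5 * (3 * L + s +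
    2)))%N _ (Inv' j.+1)) => //.
    by rewrite /q; lia.
  apply: runs_seq; apply: runs_write => /=; rewrite z5 cellE o5 //.
    by have := bz j (ltnW hj); have := bc j (ltnW hj); rewrite /c0; lia.
  apply: runs_write => /=; rewrite update_neq // z5.
    have := bz j (ltnW hj); have := bz j.+1 hj; rewrite b11 /c0.
    by rewrite (_ : j%:Z + 1 = j.+1%:Z); lia.
  split.
  + by rewrite update_eq; lia.
  + by rewrite !update_neq ?H5 //; case; rewrite /H; lia.
  + by move=> i hi; rewrite !update_neq ?o5 //; case; rewrite /s; lia.
  + move=> i hi; rewrite update_neq //; case: (eqVneq i j) => [->|/eqP hij].
      by rewrite update_eq.
    by rewrite update_neq ?r5 //; [lia | case].
- by move=> j m3 hj [i3 z3 H3 o3]; apply: guard.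
move=> j m3 hj [i3 z3 H3 o3]; have [bf rf] := hp j hj.
apply: (@runs_le _ _ (V L + ((5 * c0 + 5 * V L + 5 * (3 * L + s + 2)) + (5 * c0 + 5 * (3 * L + s
  + 2))))%N _ (Inv j.+1)) => //.
  by rewrite /q; lia.
have hl : loaded I [:: j] m3 by split.
apply: runs_seq; apply: runs_le (rf m3 hl) => // m4 [v4 fr4].
have z4 : m4 (Negz 0) = j by rewrite (frame_reg fr4).
apply: runs_seq; apply: runs_write => /=; rewrite z4 v4 cellE.
  by have := bz j (ltnW hj); have := bc j (ltnW hj); rewrite /c0; lia.
set m5 := update _ _ _.
have z5 : m5 (Negz 0) = j by rewrite /m5 update_neq ?z4 //; case; rewrite /s; lia.
apply: runs_write => /=; rewrite z5.
  have := bz j (ltnW hj); have := bz j.+1 hj; rewrite b11 /c0.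
  by rewrite (_ : j%:Z + 1 = j.+1%:Z); lia.
split.
- by move=> i; rewrite update_neq // /m5 update_neq // fr4.
- by rewrite update_eq; lia.
- rewrite update_neq; last by case; rewrite /H; lia.
  rewrite /m5 update_neq; last by case; rewrite /s; lia.
  by rewrite (frame_reg fr4) // /H; lia.
- move=> i hi; rewrite update_neq; last by case; rewrite /s; lia.
  case: (eqVneq i j) => [->|/eqP hij]; first by rewrite /m5 update_eq.
  rewrite /m5 update_neq; last by case; lia.
  by rewrite (frame_reg fr4) ?o3 //; rewrite /s /H; lia.
Qed.

(** * The Lagrangian dual and its vertices *)

Section Lines.
Variables (A : pzRingType) (n : nat) (p w v c : nat -> A).

(** A line is coded by two numbers j and tau and has the equation line_fst * lambda + line_snd
    * mu = line_rhs. For an item j < n the values 0, 1, 2 of tau stand for: full price equal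
    to profit, improved price equal to profit, and both prices equal. The remaining codes
    stand for the coordinate axes. Any ring is allowed because the program works with integers
    and the analysis with reals. *)
Definition line_fst (j tau : nat) : A :=
  if (j < n)%N then (if tau == 0%N then w j else if tau == 1%N then v j else w j - v j)
  else (tau == 0%N)%:R.
Definition line_snd (j tau : nat) : A :=
  if (j < n)%N then (if tau == 0%N then 0 else if tau == 1%N then c j else - c j)
  else (tau != 0%N)%:R.
Definition line_rhs (j tau : nat) : A :=
  if (j < n)%N && (tau < 2)%N then p j else 0.

(** The meeting point of two lines by Cramer's rule, kept as numerators and a denominator. *)
Definition meet_det (l1 l2 : nat * nat) : A :=
  line_fst l1.1 l1.2 * line_snd l2.1 l2.2 - line_fst l2.1 l2.2 * line_snd l1.1 l1.2.
Definition meet_fst (l1 l2 : nat * nat) : A :=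
  line_rhs l1.1 l1.2 * line_snd l2.1 l2.2 - line_rhs l2.1 l2.2 * line_snd l1.1 l1.2.
Definition meet_snd (l1 l2 : nat * nat) : A :=
  line_fst l1.1 l1.2 * line_rhs l2.1 l2.2 - line_fst l2.1 l2.2 * line_rhs l1.1 l1.2.
End Lines.

Section Dual.
Variables (R : realFieldType) (n : nat) (p w v c : nat -> R) (B C : R).
Variables (G S : pred nat).

(** The cost of item i at the prices z = (lambda, mu), in the cheaper of the two states. *)
Definition cheapest (i : nat) (z : R * R) : R := Num.min (z.1 * w i) (z.1 * v i + z.2 * c i).

(** The guessed items are in the solution whatever the prices are, so they contribute their
    cost without a positive part; the constant sum of their profits is left out. *)
Definition dual (z : R * R) : R :=
  z.1 * B + z.2 * C + \sum_(i < n | S i) Num.max 0 (p i - cheapest i z)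
  - \sum_(i < n | G i) cheapest i z.

Definition nonneg (z : R * R) := (0 <= z.1) && (0 <= z.2).

Definition slope (l : nat * nat) (d : R * R) : R :=
  line_fst n w v l.1 l.2 * d.1 + line_snd n c l.1 l.2 * d.2.
Definition line_val (l : nat * nat) (z : R * R) : R := slope l z - line_rhs n p l.1 l.2.

Definition same_side (za zb : R * R) : Prop :=
  forall l, (l.1 < n + 3)%N -> (l.2 < n + 3)%N -> 0 <= line_val l za * line_val l zb.

Definition mix (t : R) (za zb : R * R) : R * R :=
  (t * za.1 + (1 - t) * zb.1, t * za.2 + (1 - t) * zb.2).

Definition shift (z d : R * R) (s : R) : R * R := (z.1 + s * d.1, z.2 + s * d.2).

Lemma prod_ge0_cases (x y : R) : 0 <= x * y -> (0 <= x /\ 0 <= y) \/ (x <= 0 /\ y <= 0).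
Proof. by move=> h; case: (leP 0 x); case: (leP 0 y) => ? ?; try (by left); right; nra. Qed.

(** On a segment that crosses none of the three lines of an item, one of the three linear
    pieces of its contribution is maximal at both ends. *)
Lemma max_affine (xa xb ya yb t : R) : 0 <= t <= 1 ->
  0 <= xa * xb -> 0 <= ya * yb -> 0 <= (xa - ya) * (xb - yb) ->
  t * Num.max 0 (- Num.min xa ya) + (1 - t) * Num.max 0 (- Num.min xb yb)
    <= Num.max 0 (- Num.min (t * xa + (1 - t) * xb) (t * ya + (1 - t) * yb)).
Proof.
move=> ht hx hy hxy; set M := (X in _ <= X).
have M0 : 0 <= M by rewrite /M le_max lexx.
have Mx : - (t * xa + (1 - t) * xb) <= M.
  by rewrite /M le_max lerN2 ge_min lexx orbT.
have My : - (t * ya + (1 - t) * yb) <= M.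
  by rewrite /M le_max lerN2 ge_min lexx !orbT.
have zero : t * 0 + (1 - t) * 0 <= M by rewrite !mulr0 addr0.
have pos (a : R) : 0 <= a -> Num.max 0 (- a) = 0 by move=> h; apply/max_idPl; rewrite oppr_le0.
have neg (a : R) : a <= 0 -> Num.max 0 (- a) = - a by move=> h; apply/max_idPr; rewrite oppr_ge0.
case: (prod_ge0_cases hxy) => -[]; rewrite ?subr_ge0 ?subr_le0 => h1 h2.
  rewrite (min_idPr h1) (min_idPr h2).
  case: (prod_ge0_cases hy) => -[h3 h4]; first by rewrite !pos.
  by rewrite !neg // !mulrN -opprD.
rewrite (min_idPl h1) (min_idPl h2).
case: (prod_ge0_cases hx) => -[h3 h4]; first by rewrite !pos.
by rewrite !neg // !mulrN -opprD.
Qed.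

Lemma min_affine (xa xb ya yb t : R) : 0 <= t <= 1 -> 0 <= (xa - ya) * (xb - yb) ->
  Num.min (t * xa + (1 - t) * xb) (t * ya + (1 - t) * yb)
    <= t * Num.min xa ya + (1 - t) * Num.min xb yb.
Proof.
move=> ht hxy; rewrite ge_min.
case: (prod_ge0_cases hxy) => [[h1 h2]|[h1 h2]].
  have [-> ->] : Num.min xa ya = ya /\ Num.min xb yb = yb by split; apply/min_idPr; lra.
  by rewrite lexx orbT.
have [-> ->] : Num.min xa ya = xa /\ Num.min xb yb = xb by split; apply/min_idPl; lra.
by rewrite lexx.
Qed.

(** Two points that no line separates lie in a common cell, on which the dual is affine. *)
Lemma dual_mix za zb t : 0 <= t <= 1 -> same_side za zb ->
  t * dual za + (1 - t) * dual zb <= dual (mix t za zb).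
Proof.
move=> ht hs; rewrite /dual /=.
have hS : t * (\sum_(i < n | S i) Num.max 0 (p i - cheapest i za))
    + (1 - t) * (\sum_(i < n | S i) Num.max 0 (p i - cheapest i zb))
    <= \sum_(i < n | S i) Num.max 0 (p i - cheapest i (mix t za zb)).
  rewrite !mulr_sumr -big_split; apply: ler_sum => i _ /=.
  have i3 : (i < n + 3)%N by apply: leq_trans (ltn_ord i) (leq_addr _ _).
  have n3 k : (k < 3)%N -> (k < n + 3)%N by move=> hk; rewrite ltn_addl.
  have h0 := hs (val i, 0%N) i3 (n3 0%N isT); have h1 := hs (val i, 1%N) i3 (n3 1%N isT).
  have h2 := hs (val i, 2%N) i3 (n3 2%N isT).
  move: h0 h1 h2; rewrite /line_val /slope /line_fst /line_snd /line_rhs /= ltn_ord /= => h0 h1 h2.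
  have E (z : R * R) : p i - cheapest i z
     = - Num.min (z.1 * w i - p i) (z.1 * v i + z.2 * c i - p i).
    by rewrite /cheapest -addr_minl; ring.
  rewrite !E.
  have := @max_affine (za.1 * w i - p i) (zb.1 * w i - p i)
    (za.1 * v i + za.2 * c i - p i) (zb.1 * v i + zb.2 * c i - p i) t ht.
  move=> H; have {H} := H _ _ _.
  have -> : t * (za.1 * w i - p i) + (1 - t) * (zb.1 * w i - p i) =
     (mix t za zb).1 * w i - p i by rewrite /mix /=; ring.
  have -> : t * (za.1 * v i + za.2 * c i - p i) + (1 - t) * (zb.1 * v i + zb.2 * c i - p i) =
     (mix t za zb).1 * v i + (mix t za zb).2 * c i - p i by rewrite /mix /=; ring.
  by apply; lra.
have hG : \sum_(i < n | G i) cheapest i (mix t za zb) <=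
   t * (\sum_(i < n | G i) cheapest i za) + (1 - t) * (\sum_(i < n | G i) cheapest i zb).
  rewrite !mulr_sumr -big_split; apply: ler_sum => i _ /=.
  have i3 : (i < n + 3)%N by apply: leq_trans (ltn_ord i) (leq_addr _ _).
  have h2 := hs (val i, 2%N) i3 (ltn_addl n (isT : (2 < 3)%N)).
  move: h2; rewrite /line_val /slope /line_fst /line_snd /line_rhs /= ltn_ord /= => h2.
  have := @min_affine (za.1 * w i) (zb.1 * w i)
    (za.1 * v i + za.2 * c i) (zb.1 * v i + zb.2 * c i) t ht.
  move=> H; have {H} := H _; rewrite /cheapest /mix /=.
  have -> : t * (za.1 * w i) + (1 - t) * (zb.1 * w i) =
     (t * za.1 + (1 - t) * zb.1) * w i by ring.
  have -> : t * (za.1 * v i + za.2 * c i) + (1 - t) * (zb.1 * v i + zb.2 * c i) =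
     (t * za.1 + (1 - t) * zb.1) * v i + (t * za.2 + (1 - t) * zb.2) * c i by ring.
  by apply; lra.
move: hS hG; rewrite /=.
move: (\sum_(i < n | S i) _) (\sum_(i < n | S i) _) (\sum_(i < n | S i) _) => s1 s2 s3.
move: (\sum_(i < n | G i) _) (\sum_(i < n | G i) _) (\sum_(i < n | G i) _) => g1 g2 g3.
lra.
Qed.

Lemma line_val_shift l z d s : line_val l (shift z d s) = line_val l z + s * slope l d.
Proof. by rewrite /line_val /slope /shift /=; ring. Qed.

Lemma line_val_axis1 z : line_val (n, 0%N) z = z.1.
Proof. by rewrite /line_val /slope /line_fst /line_snd /line_rhs /= ltnn /=; ring. Qed.

Lemma line_val_axis2 z : line_val (n, 1%N) z = z.2.
Proof. by rewrite /line_val /slope /line_fst /line_snd /line_rhs /= ltnn /=; ring. Qed.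

Definition crossing (z d : R * R) l : R := - line_val l z / slope l d.

Lemma crossing_shift z d l : slope l d != 0 -> line_val l (shift z d (crossing z d l)) = 0.
Proof. by move=> h; rewrite line_val_shift /crossing; field. Qed.

(** The axes are among the lines, so that a segment free of crossings also stays in the
    quadrant. *)
Lemma dual_chord z d a s : nonneg z -> a < 0 -> 0 < s ->
  (forall l, (l.1 < n + 3)%N -> (l.2 < n + 3)%N -> slope l d != 0 ->
     crossing z d l <= a \/ s <= crossing z d l) ->
  [/\ nonneg (shift z d a), nonneg (shift z d s) &
      s * dual (shift z d a) - a * dual (shift z d s) <= (s - a) * dual z].
Proof.
move=> /andP[z1 z2] a0 s0 hr.
have hs : same_side (shift z d a) (shift z d s).
  move=> l l1 l2; rewrite !line_val_shift.
  have [e0|e0] := eqVneq (slope l d) 0; first by rewrite e0 !mulr0 !addr0 -expr2 sqr_ge0.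
  have E x : line_val l z + x * slope l d = slope l d * (x - crossing z d l) by rewrite
    /crossing; field.
  rewrite !E.
  have -> : slope l d * (a - crossing z d l) * (slope l d * (s - crossing z d l)) =
     slope l d ^+ 2 * ((a - crossing z d l) * (s - crossing z d l)) by ring.
  apply: mulr_ge0; first exact: sqr_ge0.
  by case: (hr l l1 l2 e0) => h; nra.
have n3 k : (k < 3)%N -> (n + k < n + 3)%N by rewrite ltn_add2l.
have q1 : 0 <= (shift z d a).1 * (shift z d s).1.
  have := hs (n, 0%N); rewrite !line_val_axis1; apply => /=; lia.
have q2 : 0 <= (shift z d a).2 * (shift z d s).2.
  have := hs (n, 1%N); rewrite !line_val_axis2; apply => /=; lia.
have sa : 0 < s - a by lra.
have P x y : 0 <= x -> 0 <= (x + a * y) * (x + s * y) -> 0 <= x + a * y /\ 0 <= x + s * y.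
  move=> x0 /prod_ge0_cases[//|[h1 h2]].
  have [y0|y0] := leP 0 y; split; nra.
(* z divides the segment between its shifts by a and by s in this ratio. *)
pose t := s / (s - a).
have ht : 0 <= t <= 1.
  by rewrite /t divr_ge0 ?(ltW sa) ?(ltW s0) //= ler_pdivrMr // mul1r; lra.
have et : (s - a) * t = s by rewrite /t; field; rewrite gt_eqF.
have := dual_mix ht hs.
have -> : mix t (shift z d a) (shift z d s) = z.
  case: (z) => x y; rewrite /mix /shift /=.
  have E x0 d0 : t * (x0 + a * d0) + (1 - t) * (x0 + s * d0) = x0 + (s - (s - a) * t) * d0.
    by ring.
  by rewrite !E et subrr !mul0r !addr0.
move=> hD; split.
- by apply/andP; split=> /=; [case: (P _ _ z1 q1) | case: (P _ _ z2 q2)].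
- by apply/andP; split=> /=; [case: (P _ _ z1 q1) | case: (P _ _ z2 q2)].
have -> : s * dual (shift z d a) - a * dual (shift z d s) =
  (s - a) * (t * dual (shift z d a) + (1 - t) * dual (shift z d s)).
  transitivity ((s - a) * t * dual (shift z d a)
    + (s - a - (s - a) * t) * dual (shift z d s)); last by ring.
  by rewrite et; ring.
by rewrite ler_pM2l.
Qed.

Hypothesis dual_ge0 : forall z, nonneg z -> 0 <= dual z.

Lemma shift0 z d : shift z d 0 = z.
Proof. by case: z => x y; rewrite /shift /= !mul0r !addr0. Qed.

Definition line_index := ('I_(n + 3) * 'I_(n + 3))%type.
Definition pair_of (l : line_index) : nat * nat := (val l.1, val l.2).

(** Go back to the last crossing behind z. If there is also a crossing ahead, the dual is
    affine in between and does not increase towards one of the two. Otherwise it is affine on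
    a whole ray, where it is bounded below, so that it does not increase towards the crossing
    behind. *)
Lemma descend_back z d (l0 : line_index) : nonneg z -> slope (pair_of l0) d != 0 ->
  crossing z d (pair_of l0) <= 0 ->
  exists (l : line_index) s, [/\ slope (pair_of l) d != 0, s = crossing z d (pair_of l),
    nonneg (shift z d s) & dual (shift z d s) <= dual z].
Proof.
move=> hz sl0 r0; pose r (l : line_index) := crossing z d (pair_of l).
pose neg := [pred l : line_index | (slope (pair_of l) d != 0) && (r l <= 0)].
have neg0 : neg l0 by rewrite /= sl0.
case: (@arg_maxP _ _ _ l0 neg r neg0) => la /andP[sla rla] ha.
have [ra|ra] := eqVneq (r la) 0.
  by exists la, (r la); rewrite ra shift0; split.
have {}rla : r la < 0 by rewrite lt_neqAle ra.
pose pos := [pred l : line_index | (slope (pair_of l) d != 0) && (0 < r l)].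
have cover s : (forall l, pos l -> s <= r l) ->
  forall l, (l.1 < n + 3)%N -> (l.2 < n + 3)%N -> slope l d != 0 ->
     crossing z d l <= r la \/ s <= crossing z d l.
  move=> hs [j tau] /= l1 l2 sl; pose l : line_index := (Ordinal l1, Ordinal l2).
  have [h|h] := leP (r l) 0; [left|right].
    by apply: (ha l); rewrite /= /pair_of /= sl.
  by apply: (hs l); rewrite /= /pair_of /= sl.
have [/existsP[l1 hl1]|/existsPn hpos] := boolP [exists l, pos l].
  case: (@arg_minP _ _ _ l1 pos r hl1) => lb /andP[slb rlb] hb.
  have [na nb le] := dual_chord hz rla rlb (cover _ hb).
  have [h|h] := leP (dual (shift z d (r la))) (dual z); first by exists la, (r la).
  exists lb, (r lb); split=> //.
  by rewrite leNgt; apply/negP => h'; nra.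
exists la, (r la).
have cov s : forall l, pos l -> s <= r l by move=> l hl; case/negP: (hpos l).
have [na _ _] := dual_chord hz rla ltr01 (cover 1 (cov 1)).
split => //; rewrite leNgt; apply/negP => h.
(* So far along the ray that an affine function that decreased would be negative. *)
pose s := (1 - r la * dual z) / (dual (shift z d (r la)) - dual z).
have dz := dual_ge0 hz.
have dd : 0 < dual (shift z d (r la)) - dual z by rewrite subr_gt0.
have s0 : 0 < s by apply: divr_gt0 => //; nra.
have es : s * (dual (shift z d (r la)) - dual z) = 1 - r la * dual z.
  by rewrite /s mulfVK // gt_eqF.
have [_ ns le] := dual_chord hz rla s0 (cover s (cov s)).
have := dual_ge0 ns; nra.
Qed.

(** The quadrant contains no full line, so there is a crossing in one of the two
    directions. *)
Lemma descend z d : nonneg z -> d != 0 ->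
  exists (l : line_index) s, [/\ slope (pair_of l) d != 0, line_val (pair_of l) (shift z d s) = 0,
    nonneg (shift z d s) & dual (shift z d s) <= dual z].
Proof.
move=> hz d0.
have [l0 sl0] : exists l : line_index, slope (pair_of l) d != 0.
  have h0 : (0 < n + 3)%N by lia. have h1 : (1 < n + 3)%N by lia.
  have hn : (n < n + 3)%N by lia.
  have [e1|e1] := eqVneq d.1 0; last first.
    exists (Ordinal hn, Ordinal h0).
    by rewrite /slope /line_fst /line_snd /= ltnn /= mul1r mul0r addr0.
  have [e2|e2] := eqVneq d.2 0.
    by case/eqP: d0; move: e1 e2; case: (d) => x y /= -> ->.
  exists (Ordinal hn, Ordinal h1).
  by rewrite /slope /line_fst /line_snd /= ltnn /= mul1r mul0r add0r.
have [h|h] := leP (crossing z d (pair_of l0)) 0.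
  have [l [s [h1 h2 h3 h4]]] := descend_back hz sl0 h.
  by exists l, s; split=> //; rewrite h2 crossing_shift.
pose d' : R * R := (- d.1, - d.2).
have sN l : slope l d' = - slope l d by rewrite /slope /d' /=; ring.
have [||l [s [h1 h2 h3 h4]]] := @descend_back z d' l0 hz; first by rewrite sN oppr_eq0.
  by rewrite /crossing sN invrN mulrN oppr_le0; apply: ltW.
have eN : shift z d' s = shift z d (- s) by rewrite /shift /d' /= !mulrN !mulNr.
exists l, (- s); rewrite -eN; split=> //; first by move: h1; rewrite sN oppr_eq0.
by rewrite h2 crossing_shift.
Qed.

(** Two descents: an arbitrary one reaches some line, and one along this line reaches
    another. *)
Lemma vertex_below z : nonneg z ->
  exists (l1 l2 : line_index) z', [/\ meet_det n w v c (pair_of l1) (pair_of l2) != 0,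
    line_val (pair_of l1) z' = 0, line_val (pair_of l2) z' = 0, nonneg z' & dual z' <= dual z].
Proof.
move=> hz.
(* Any first direction will do. *)
have [|l1 [s1 [h1 v1 n1 d1]]] := @descend z (1, 0) hz.
  by apply/eqP => -[/eqP]; rewrite oner_eq0.
move: h1; set z1 := shift _ _ _ in v1 n1 d1 *.
rewrite /slope /= mulr1 mulr0 addr0 => h1.
pose d : R * R := (- line_snd n c (pair_of l1).1 (pair_of l1).2,
  line_fst n w v (pair_of l1).1 (pair_of l1).2).
have [|l2 [s2 [h2 v2 n2 d2]]] := @descend z1 d n1.
  by apply/eqP => -[_ /eqP]; apply/negP.
exists l1, l2, (shift z1 d s2); split=> //.
- by move: h2; rewrite /slope /meet_det /d /=; congr (_ != 0); ring.
- by rewrite line_val_shift v1 /slope /d /=; ring.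
- exact: le_trans d2 d1.
Qed.

Definition meet_point (l1 l2 : nat * nat) : R * R :=
  (meet_fst n p c l1 l2 / meet_det n w v c l1 l2,
   meet_snd n p w v l1 l2 / meet_det n w v c l1 l2).

Lemma meet_unique l1 l2 z : meet_det n w v c l1 l2 != 0 -> line_val l1 z = 0 -> line_val l2 z = 0 ->
  z = meet_point l1 l2.
Proof.
move=> hd; rewrite /line_val /meet_point /meet_fst /meet_snd => /subr0_eq <- /subr0_eq <-.
by case: z => x y; rewrite /slope /=; congr pair; move: hd; rewrite /meet_det => hd; field.
Qed.

(** Every point is dominated by one of finitely many vertices, so the best vertex is a global
    minimiser. *)
Lemma dual_minimiser : exists l1 l2 : line_index,
  [/\ meet_det n w v c (pair_of l1) (pair_of l2) != 0,
    nonneg (meet_point (pair_of l1) (pair_of l2)) &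
    forall z, nonneg z -> dual (meet_point (pair_of l1) (pair_of l2)) <= dual z].
Proof.
pose pt (l : line_index * line_index) : R * R := meet_point (pair_of l.1) (pair_of l.2).
pose vert := [pred l : line_index * line_index |
  (meet_det n w v c (pair_of l.1) (pair_of l.2) != 0) && nonneg (pt l)].
have below z : nonneg z -> exists2 l, vert l & dual (pt l) <= dual z.
  move=> /vertex_below[l1 [l2 [z' [h1 h2 h3 h4 h5]]]].
  have ez : pt (l1, l2) = z' by rewrite (meet_unique h1 h2 h3).
  by exists (l1, l2); rewrite /= ez // h1 h4.
have [|l0 hl0 _] := below (0, 0); first by rewrite /nonneg /= lexx.
case: (@arg_minP _ _ _ l0 vert (fun l => dual (pt l)) hl0) => -[l1 l2] /andP[h1 h2] hmin.
exists l1, l2; split=> // z /below[l hl]; exact: le_trans (hmin l hl).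
Qed.
End Dual.

(** * Rounding at a minimiser of the dual *)

Section Rounding.
Variables (R : realFieldType) (n : nat) (p w v c : nat -> R) (B C : R).
Variables (G S : pred nat).
Hypothesis v_ge0 : forall i, (i < n)%N -> 0 <= v i.
Hypothesis v_lt_w : forall i, (i < n)%N -> v i < w i.
Hypothesis c_gt0 : forall i, (i < n)%N -> 0 < c i.
Hypothesis S_free : forall i, S i -> ~~ G i.

Local Notation g := (cheapest w v c).
Local Notation D := (dual n p w v c B C G S).

Lemma cheapest_ge0 i z : (i < n)%N -> nonneg z -> 0 <= g i z.
Proof.
move=> hi /andP[z1 z2]; have := v_ge0 hi; have := v_lt_w hi; have := c_gt0 hi.
by move=> ? ? ?; rewrite /cheapest le_min; apply/andP; split; nra.
Qed.

Lemma cheapest_shift i z d t : 0 <= t -> g i z + t * g i d <= g i (shift z d t).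
Proof.
move=> t0; rewrite /cheapest /shift /= le_min.
have z1 : g i z <= z.1 * w i by rewrite /cheapest ge_min lexx.
have z2 : g i z <= z.1 * v i + z.2 * c i by rewrite /cheapest ge_min lexx orbT.
have d1 : t * g i d <= t * (d.1 * w i) by rewrite ler_wpM2l // /cheapest ge_min lexx.
have d2 : t * g i d <= t * (d.1 * v i + d.2 * c i).
  by rewrite ler_wpM2l // /cheapest ge_min lexx orbT.
move: z1 z2 d1 d2; rewrite /cheapest => z1 z2 d1 d2.
by apply/andP; split; lra.
Qed.

Lemma cheapest_scale i z t : 0 <= t -> g i (t * z.1, t * z.2) = t * g i z.
Proof.
move=> t0; rewrite /cheapest /= -!mulrA -mulrDr.
by rewrite minr_pMr.
Qed.

(** An item taken with improvement y costs (x - y) times its full price plus y times its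
    improved price, which is at least x times the cheaper of the two. *)
Lemma weak_duality (x : 'I_n -> bool) (y : 'I_n -> R) z : nonneg z ->
  (forall i, 0 <= y i <= (x i)%:R) ->
  \sum_(i < n) w i * (x i)%:R - \sum_(i < n) (w i - v i) * y i <= B ->
  \sum_(i < n) c i * y i <= C ->
  (forall i : 'I_n, G i -> x i) -> (forall i : 'I_n, x i -> G i || S i) ->
  \sum_(i < n | S i) p i * (x i)%:R <= D z.
Proof.
move=> /andP[z1 z2] hy hB hC hG hx.
apply: (@le_trans _ _ (z.1 * (\sum_(i < n) w i * (x i)%:R - \sum_(i < n) (w i - v i) * y i)
   + z.2 * (\sum_(i < n) c i * y i) + \sum_(i < n | S i) Num.max 0 (p i - g i z)
  - \sum_(i < n | G i) g i z)); last first.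
  by rewrite /dual lerD2r lerD2r; apply: lerD; rewrite ler_wpM2l.
rewrite -subr_ge0 -sumrB !mulr_sumr !(big_mkcond (fun i : 'I_n => S i)).
rewrite !(big_mkcond (fun i : 'I_n => G i)).
rewrite -!big_split -!sumrB; apply: sumr_ge0 => i _ /=.
have hw := v_lt_w (ltn_ord i); have hc := c_gt0 (ltn_ord i); have hv := v_ge0 (ltn_ord i).
have g1 : g i z <= z.1 * w i by rewrite /cheapest ge_min lexx.
have g2 : g i z <= z.1 * v i + z.2 * c i by rewrite /cheapest ge_min lexx orbT.
have g0 := cheapest_ge0 (ltn_ord i) (introT andP (conj z1 z2)).
have M0 : 0 <= Num.max 0 (p i - g i z) by rewrite le_max lexx.
have M1 : p i - g i z <= Num.max 0 (p i - g i z) by rewrite le_max lexx orbT.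
move: M0 M1; set M := Num.max _ _ => M0 M1.
have /andP[y0 y1] := hy i.
have gx : g i z * (x i)%:R <= z.1 * (w i * (x i)%:R - (w i - v i) * y i) + z.2 * (c i * y i).
  have : 0 <= (z.1 * w i - g i z) * ((x i)%:R - y i) by rewrite mulr_ge0 ?subr_ge0.
  have : 0 <= (z.1 * v i + z.2 * c i - g i z) * y i by rewrite mulr_ge0 ?subr_ge0.
  by nra.
have := hG i; have := hx i; have := @S_free i.
case: (S i); case: (G i); case: (x i) gx => //= gx a1 a2 a3; rewrite ?mulr1 ?mulr0 in gx *; try lra.
Qed.

(** Bounds a step so short that no strict inequality between profit and cost is reversed. *)
Lemma small_step (a b : 'I_n -> R) : exists2 t, 0 < t < 1 & forall i, 0 < b i -> t * a i <= b i.
Proof.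
suff [t ht h] : exists2 t, 0 < t < 1 & forall i, i \in enum 'I_n -> 0 < b i -> t * a i <= b i.
  by exists t => // i; apply: h; rewrite mem_enum.
elim: (enum 'I_n) => [|i s [t /andP[t0 t1] h]]; first by exists (1 / 2) => //; lra.
have [bi|bi] := ltP 0 (b i); last first.
  exists t; first by rewrite t0.
  by move=> j; rewrite inE => /orP[/eqP -> | /h //]; rewrite ltNge bi.
(* Adding 1 avoids a division by zero. *)
pose u := Num.min t (b i / (1 + `|a i|)).
have na : 0 <= `|a i| by []. have n1 : 0 < 1 + `|a i| by lra.
have u0 : 0 < u by rewrite /u lt_min t0 divr_gt0.
have ut : u <= t by rewrite /u ge_min lexx.
have ub : u * (1 + `|a i|) <= b i by rewrite -ler_pdivlMr // /u ge_min lexx orbT.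
exists u; first by rewrite u0 (le_lt_trans ut).
move=> j; rewrite inE => /orP[/eqP -> _| hj bj]; first by have := ler_norm (a i); nra.
have := h j hj bj; have [a0|a0] := leP 0 (a j); nra.
Qed.

Variable z : R * R.
Hypothesis z_ge0 : nonneg z.
Hypothesis z_min : forall z', nonneg z' -> D z <= D z'.

(** The right derivative of the dual at z in the direction d is nonnegative. As the cost is
    concave and homogeneous, it grows at least as fast as g(d), which gives the inequality. *)
Lemma minimiser_feasible d : nonneg d ->
  \sum_(i < n | G i || S i && (g i z < p i)) g i d <= d.1 * B + d.2 * C.
Proof.
move=> hd; have /andP[d1 d2] := hd; have /andP[z1 z2] := z_ge0.
have [t /andP[t0 t1] ht] := small_step (fun i => g i d) (fun i => p i - g i z).
have n' : nonneg (shift z d t).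
  by apply/andP; split => /=; rewrite addr_ge0 // mulr_ge0 // ltW.
have h := z_min n'; rewrite /dual in h; rewrite -(ler_pM2l t0).
suff : t * (\sum_(i < n | G i || S i && (g i z < p i)) g i d)
   + \sum_(i < n | S i) Num.max 0 (p i - g i (shift z d t))
   - \sum_(i < n | G i) g i (shift z d t)
   <= \sum_(i < n | S i) Num.max 0 (p i - g i z) - \sum_(i < n | G i) g i z.
  by move: h; rewrite /shift /=; lra.
rewrite mulr_sumr !(big_mkcond (fun i : 'I_n => S i)) !(big_mkcond (fun i : 'I_n => G i)).
rewrite (big_mkcond (fun i : 'I_n => G i || S i && (g i z < p i))) -big_split -!sumrB.
apply: ler_sum => i _ /=.
have gs := cheapest_shift i z d (ltW t0).
have gd := cheapest_ge0 (ltn_ord i) hd.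
have tgd : 0 <= t * g i d by rewrite mulr_ge0 // ltW.
have hti := ht i; rewrite subr_gt0 in hti.
move: (@S_free i); case: (S i) => /= [/(_ isT)/negPf -> /= | _]; last first.
  by case: (G i) => /=; lra.
rewrite !subr0; case: (ltP (g i z) (p i)) hti => [h1 /(_ isT) h2|h1 _].
  rewrite [X in _ <= X]max_r ?subr_ge0 ?(ltW h1) // -lerBrDl ge_max.
  by apply/andP; split; lra.
by rewrite add0r ge_max !le_max lexx /=; apply/orP; left; lra.
Qed.

(** The derivative of the dual at z in the direction -z is nonnegative. Along this ray the
    costs are linear, so it compares lambda B + mu C with the costs of the items that pay for
    themselves. *)
Lemma dual_le_taken : D z <= \sum_(i < n | S i && (g i z <= p i)) p i.
Proof.
have /andP[z1 z2] := z_ge0.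
have [t /andP[t0 t1] ht] := small_step (fun i => g i z) (fun i => g i z - p i).
pose z' : R * R := ((1 - t) * z.1, (1 - t) * z.2).
have t1' : 0 <= 1 - t by lra.
have n' : nonneg z' by apply/andP; split; rewrite /= mulr_ge0.
have gz' i : g i z' = (1 - t) * g i z by rewrite cheapest_scale.
have h := z_min n'.
have hS : \sum_(i < n | S i) Num.max 0 (p i - g i z') <=
   \sum_(i < n | S i) Num.max 0 (p i - g i z) + t * \sum_(i < n | S i && (g i z <= p i)) g i z.
  rewrite big_mkcondr mulr_sumr -big_split; apply: ler_sum => i Si /=.
  have g0 := cheapest_ge0 (ltn_ord i) z_ge0.
  rewrite gz'; have hti := ht i; rewrite subr_gt0 in hti.
  case: (ltP (p i) (g i z)) hti => [h1 /(_ isT) h2|h1 _].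
    by rewrite mulr0 addr0 ge_max !le_max lexx /=; apply/orP; left; lra.
  have tg : 0 <= t * g i z by rewrite mulr_ge0 // ltW.
  rewrite [X in _ <= X + _]max_r ?subr_ge0 // ge_max; apply/andP; split; lra.
have hG : \sum_(i < n | G i) g i z' = (1 - t) * \sum_(i < n | G i) g i z.
  by rewrite mulr_sumr; apply: eq_bigr => i _.
have key : z.1 * B + z.2 * C <= \sum_(i < n | S i && (g i z <= p i)) g i z + \sum_(i < n | G i) g
  i z.
  rewrite -(ler_pM2l t0); move: h hS; rewrite /dual hG /z' /=; lra.
have hE : \sum_(i < n | S i) Num.max 0 (p i - g i z) =
    \sum_(i < n | S i && (g i z <= p i)) p i - \sum_(i < n | S i && (g i z <= p i)) g i z.
  rewrite -sumrB big_mkcondr; apply: eq_bigr => i Si.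
  by case: leP => h1; [rewrite max_r // subr_ge0 | rewrite max_l // subr_le0 ltW].
by rewrite /dual hE; lra.
Qed.
End Rounding.

(** * Improving greedily *)

Section Greedy.
Variables (n : nat) (w v c : nat -> int) (B C : int) (X : pred nat) (t : nat).

Definition steeper (i : nat) : bool := (w t - v t) * c i < (w i - v i) * c t.
Definition level (i : nat) : bool := (w t - v t) * c i == (w i - v i) * c t.
Definition steeper_cost : int := \sum_(i < n | X i && steeper i) c i.
Definition level_cost : int := \sum_(i < n | X i && level i) c i.
(** All y_i share the denominator [y_den]: an item is improved fully, by the fraction y_cut /
    y_den, or not at all, according to its ratio (w_i - v_i) / c_i compared with that of the
    threshold item t. Items with the same ratio as t all get the same fraction, so no order
    between them has to be fixed. *)
Definition y_den : int := if 0 < level_cost then level_cost else 1.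
Definition y_cut : int := Num.min y_den (C - steeper_cost).
Definition y_num (i : nat) : int :=
  if X i then (if steeper i then y_den else if level i then y_cut else 0) else 0.
Definition fits : bool :=
  [&& 0 <= y_cut, \sum_(i < n) c i * y_num i <= C * y_den &
      y_den * (\sum_(i < n | X i) w i) - \sum_(i < n) (w i - v i) * y_num i <= B * y_den].

Lemma y_den_gt0 : 0 < y_den.
Proof. by rewrite /y_den; case: ifP. Qed.

Lemma sum_split3 (F : nat -> int) : \sum_(i < n | X i) F i =
  \sum_(i < n | X i && steeper i) F i + \sum_(i < n | X i && level i) F i
  + \sum_(i < n | X i && ~~ steeper i && ~~ level i) F i.
Proof.
rewrite (bigID (fun i : 'I_n => steeper i)) /= -addrA; congr (_ + _).
rewrite (bigID (fun i : 'I_n => level i)) /=; congr (_ + _).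
apply: eq_bigl => i; rewrite -andbA; congr (_ && _).
by rewrite /steeper /level; case: ltgtP.
Qed.

Lemma sum_y_num (F : nat -> int) : \sum_(i < n) F i * y_num i =
  y_den * (\sum_(i < n | X i && steeper i) F i) + y_cut * (\sum_(i < n | X i && level i) F i).
Proof.
rewrite !mulr_sumr (big_mkcond (fun i : 'I_n => X i && steeper i)).
rewrite (big_mkcond (fun i : 'I_n => X i && level i)) -big_split; apply: eq_bigr => i _ /=.
rewrite /y_num /steeper /level; case: (X i) => /=; last by rewrite mulr0 addr0.
by case: ltgtP => _; rewrite ?mulr0 ?addr0 ?add0r // mulrC.
Qed.
End Greedy.

(** If the whole set can be improved, the least ratio is a valid threshold. Otherwise take the
    largest ratio at which improving all items of at least this ratio exceeds the budget. The
    cut then spends the budget exactly, and the hypothesis for d = (c_t, w_t - v_t) is the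
    knapsack constraint. *)
Lemma greedy_fits n (w v c : nat -> int) (B C : int) (X : pred nat) :
  (forall i, (i < n)%N -> v i < w i) -> (forall i, (i < n)%N -> 0 < c i) ->
  0 <= B -> 0 <= C ->
  (forall d1 d2 : int, 0 <= d1 -> 0 <= d2 ->
     \sum_(i < n | X i) Num.min (d1 * w i) (d1 * v i + d2 * c i) <= d1 * B + d2 * C) ->
  exists2 t, (t < n + 3)%N & fits n w v c B C X t.
Proof.
move=> vw c0 B0 C0 hd.
have [/existsP[i0 Xi0]|/existsPn noX] := boolP [exists i : 'I_n, X i]; last first.
  have e0 P (F : nat -> int) : \sum_(i < n | X i && P i) F i = 0.
    by rewrite big_pred0 // => i; rewrite (negPf (noX i)).
  have e1 (F : nat -> int) : \sum_(i < n | X i) F i = 0.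
    by rewrite big_pred0 // => i; rewrite (negPf (noX i)).
  have yd : y_den n w v c X 0 = 1 by rewrite /y_den /level_cost e0.
  have yc : 0 <= y_cut n w v c C X 0.
    by rewrite /y_cut yd /steeper_cost e0 subr0 le_min C0.
  exists 0%N; first by lia.
  by rewrite /fits (sum_y_num _ _ _ _ _ _ _ c) (sum_y_num _ _ _ _ _ _ _ (fun i => w i - v i)) yc
    yd ?e0 ?(e0 _ (fun i => w i - v i)) ?e0 e1 !mulr0 ?mulr1 ?subr0 ?addr0 ?sub0r ?oppr0;
      apply/andP; split; lia.
pose key (i : 'I_n) : rat := (w i - v i)%:~R / (c i)%:~R.
have keylt (i j : 'I_n) : (key i < key j) = ((w i - v i) * c j < (w j - v j) * c i).
  rewrite /key ltr_pdivrMr ?ltr0z ?c0 // mulrAC ltr_pdivlMr ?ltr0z ?c0 //.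
  by rewrite -!intrM ltr_int.
have keyeq (i j : 'I_n) : (key i == key j) = ((w i - v i) * c j == (w j - v j) * c i).
  by rewrite !eq_le !leNgt !keylt.
have lc0 (t : 'I_n) : X t -> 0 < level_cost n w v c X t.
  move=> Xt; rewrite /level_cost (bigD1 t) /=; last by rewrite Xt /level eqxx.
  apply: ltr_pwDl; first exact: c0.
  by apply: sumr_ge0 => i _; rewrite ltW ?c0.
have [total|total] := leP (\sum_(i < n | X i) c i) C.
  case: (@arg_minP _ _ _ i0 (fun i : 'I_n => X i) key Xi0) => t Xt ht.
  have below (F : nat -> int) :
     \sum_(i < n | X i && ~~ steeper w v c t i && ~~ level w v c t i) F i = 0.
    rewrite big_pred0 // => i; apply/negP => /andP[/andP[Xi s] l].
    by have := ht i Xi; rewrite leNgt keylt; move: s l; rewrite /steeper /level; case: ltgtP.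
  exists (val t); first exact: leq_trans (ltn_ord t) (leq_addr _ _).
  have yd : y_den n w v c X t = level_cost n w v c X t by rewrite /y_den lc0.
  move: total; rewrite (sum_split3 _ w v c X t) below addr0 => total.
  have yc : y_cut n w v c C X t = level_cost n w v c X t.
    by rewrite /y_cut yd; apply/min_idPl; move: total; rewrite /steeper_cost /level_cost; lia.
  have h10 := hd 1 0 isT isT; rewrite mul1r mul0r addr0 in h10.
  have {}h10 : \sum_(i < n | X i) v i <= B.
    apply: le_trans h10; rewrite le_eqVlt; apply/orP; left; apply/eqP; apply: eq_bigr => i _.
    by rewrite !mul1r mul0r addr0 min_r // ltW ?vw.
  have l0 := lc0 t Xt.
  rewrite /fits (sum_y_num _ _ _ _ _ _ _ c) (sum_y_num _ _ _ _ _ _ _ (fun i => w i - v i)) yd yc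
    ltW //= (sum_split3 _ w v c X t) below addr0.
  move: h10; rewrite (sum_split3 _ w v c X t) below addr0 !sumrB.
  move: total l0; rewrite -/(steeper_cost n w v c X t) -/(level_cost n w v c X t).
  move: (steeper_cost _ _ _ _ _ _) (level_cost _ _ _ _ _ _) => a e.
  set wa := \sum_(i < n | X i && steeper w v c t i) w i.
  set wl := \sum_(i < n | X i && level w v c t i) w i.
  set va := \sum_(i < n | X i && steeper w v c t i) v i.
  set vl := \sum_(i < n | X i && level w v c t i) v i.
  by move=> h1 h2 h3; apply/andP; split; nia.
pose big (t : 'I_n) := X t && (C < steeper_cost n w v c X t + level_cost n w v c X t).
have [u Xu hu] : exists2 u : 'I_n, X u & big u.
  case: (@arg_minP _ _ _ i0 (fun i : 'I_n => X i) key Xi0) => t Xt ht.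
  have below (F : nat -> int) :
     \sum_(i < n | X i && ~~ steeper w v c t i && ~~ level w v c t i) F i = 0.
    rewrite big_pred0 // => i; apply/negP => /andP[/andP[Xi s] l].
    by have := ht i Xi; rewrite leNgt keylt; move: s l; rewrite /steeper /level; case: ltgtP.
  by exists t => //; rewrite /big Xt /=; move: total; rewrite (sum_split3 _ w v c X t) below addr0.
case: (@arg_maxP _ _ _ u big key hu) => t /andP[Xt hbig] ht.
exists (val t); first exact: leq_trans (ltn_ord t) (leq_addr _ _).
have yd : y_den n w v c X t = level_cost n w v c X t by rewrite /y_den lc0.
have l0 := lc0 t Xt.
have aC : steeper_cost n w v c X t <= C.
  rewrite leNgt; apply/negP => hC.
  have [s0 hs0] : exists s0 : 'I_n, X s0 && steeper w v c t s0.
    apply/existsP; have [//|/existsPn h] := boolP [exists s0 : 'I_n, X s0 && steeper w v c t s0].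
    by move: hC; rewrite /steeper_cost big_pred0 ?ltNge ?C0 // => i; exact: negPf (h i).
  case: (@arg_minP _ _ _ s0 (fun i : 'I_n => X i && steeper w v c t i) key hs0) => s /andP[Xs st]
    hs.
  have lt : key t < key s by rewrite keylt.
  suff bs : big s by have /= := ht s bs; rewrite leNgt lt.
  rewrite /big Xs /=; apply: lt_le_trans hC _.
  have -> : steeper_cost n w v c X t =
     \sum_(i < n | X i && steeper w v c t i) c i by [].
  rewrite /steeper_cost /level_cost (big_mkcond (fun i : 'I_n => X i && steeper w v c t i)).
  rewrite (big_mkcond (fun i : 'I_n => X i && steeper w v c s i)).
  rewrite (big_mkcond (fun i : 'I_n => X i && level w v c s i)) -big_split.
  apply: ler_sum => i _ /=; case: (X i) (hs i) => //= hsi.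
  rewrite /steeper /level -!keylt -keyeq in hsi *.
  have ci := ltW (c0 i (ltn_ord i)).
  case: (ltP (key t) (key i)) hsi => [_ /(_ isT)|_ _]; last first.
    by case: (_ < _); case: (_ == _); rewrite ?addr0 ?add0r //; rewrite addr_ge0.
  by case: ltgtP => // _ _; rewrite ?addr0 ?add0r.
have yc : y_cut n w v c C X t = C - steeper_cost n w v c X t.
  by rewrite /y_cut yd; apply/min_idPr; lia.
have hrow : c t * (\sum_(i < n | X i && level w v c t i) w i)
   = c t * (\sum_(i < n | X i && level w v c t i) v i) + (w t - v t) * level_cost n w v c X t.
  rewrite /level_cost !mulr_sumr -big_split; apply: eq_bigr => i /andP[_ /eqP hl] /=.
  by rewrite hl; ring.
have ct := c0 t (ltn_ord t). have rt : 0 < w t - v t by rewrite subr_gt0 vw.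
have := hd (c t) (w t - v t) (ltW ct) (ltW rt).
have -> : \sum_(i < n | X i) Num.min (c t * w i) (c t * v i + (w t - v t) * c i) =
   c t * (\sum_(i < n | X i && steeper w v c t i) v i) + (w t - v t) * steeper_cost n w v c X t
   + (c t * (\sum_(i < n | X i && level w v c t i) v i) + (w t - v t) * level_cost n w v c X t)
   + c t * (\sum_(i < n | X i && ~~ steeper w v c t i && ~~ level w v c t i) w i).
  rewrite (sum_split3 _ w v c X t (fun i => Num.min (c t * w i) (c t * v i + (w t - v t) * c i))).
  rewrite /steeper_cost /level_cost !mulr_sumr -!big_split; congr (_ + _ + _);
    apply: eq_bigr => i /=.
  - by move=> /andP[_]; rewrite /steeper => h; rewrite min_r //; lia.
  - by move=> /andP[_]; rewrite /level => h; rewrite min_r //; lia.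
  - move=> /andP[/andP[_]]; rewrite /steeper /level => h1 h2; rewrite min_l //.
    by case: ltgtP h1 h2 => // h _ _; lia.
rewrite /fits (sum_y_num _ _ _ _ _ _ _ c) (sum_y_num _ _ _ _ _ _ _ (fun i => w i - v i)) yd yc
  (sum_split3 _ w v c X t) !sumrB.
move: hbig aC l0 hrow; rewrite -/(steeper_cost n w v c X t) -/(level_cost n w v c X t).
move: (steeper_cost _ _ _ _ _ _) (level_cost _ _ _ _ _ _) => a e.
set wa := \sum_(i < n | X i && steeper w v c t i) w i.
set wl := \sum_(i < n | X i && level w v c t i) w i.
set va := \sum_(i < n | X i && steeper w v c t i) v i.
set vl := \sum_(i < n | X i && level w v c t i) v i.
set wb := \sum_(i < n | _) w i.
move: ct rt; move: (c t) (w t - v t) => ct r ct0 r0 h1 h2 h3 h4 h5.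
apply/and3P; split; [lia | nia |].
rewrite -subr_ge0 -(pmulr_rge0 _ ct0).
have -> : ct * (B * e - (e * (wa + wl + wb) - (e * (wa - va) + (C - a) * (wl - vl)))) =
   e * (ct * B - ct * va - ct * wb) - e * (ct * wl) + (C - a) * (ct * wl - ct * vl) by ring.
rewrite h4; have -> : e * (ct * B - ct * va - ct * wb) - e * (ct * vl + r * e) +
   (C - a) * (ct * vl + r * e - ct * vl) =
   e * (ct * B + r * C - (ct * va + r * a + (ct * vl + r * e) + ct * wb)) by ring.
by rewrite mulr_ge0 ?subr_ge0 // ltW.
Qed.

(** * Perturbed profits and ties *)

Section Perturbation.
Variables (n : nat) (P w v c : nat -> int).

(** Exceeds the entries and the 2 x 2 determinants of the vectors (w_i, 0) and (v_i, c_i), so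
    that a relation between perturbed profits with such coefficients can be read off digit by
    digit. *)
Definition radix : int := ((\sum_(i < n) w i) + 1) * ((\sum_(i < n) c i) + 1) + 1.
(** The power radix ^ i written with a loop whose length does not depend on i. *)
Definition place (i : nat) : int := \prod_(j < n) (if (j < i)%N then radix else 1).
Definition perturbed (i : nat) : int := place n * P i + place i.

(** The sign that makes the common denominator of the meeting point positive. *)
Definition orient (l1 l2 : nat * nat) : int := if 0 < meet_det n w v c l1 l2 then 1 else -1.
(** The test p_i > g_i at the meeting point of two lines, multiplied by the common denominator
    so that it stays in the integers. *)
Definition profitable (l1 l2 : nat * nat) (i : nat) : bool :=
  let s := orient l1 l2 in
  let d := s * meet_det n w v c l1 l2 in
  let z1 := s * meet_fst n perturbed c l1 l2 in
  let z2 := s * meet_snd n perturbed w v l1 l2 in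
  (w i * z1 < perturbed i * d) || (v i * z1 + c i * z2 < perturbed i * d).

Lemma placeE i : (i <= n)%N -> place i = radix ^+ i.
Proof.
move=> hi; rewrite /place -big_mkcond /= prodr_const; congr (_ ^+ _).
rewrite -[RHS]card_ord -sum1_card -[RHS]sum1_card.
rewrite (eq_bigl (fun j : 'I_n => (j < i)%N)) //.
by rewrite (big_ord_narrow hi).
Qed.

Hypothesis P_ge0 : forall i, (i < n)%N -> 0 <= P i.
Hypothesis v_ge0 : forall i, (i < n)%N -> 0 <= v i.
Hypothesis v_lt_w : forall i, (i < n)%N -> v i < w i.
Hypothesis c_gt0 : forall i, (i < n)%N -> 0 < c i.

Lemma w_le_sum i : (i < n)%N -> w i <= \sum_(i < n) w i.
Proof.
move=> hi; rewrite (bigD1 (Ordinal hi)) //= lerDl; apply: sumr_ge0 => j _.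
exact: le_trans (v_ge0 _) (ltW (v_lt_w _)).
Qed.

Lemma c_le_sum i : (i < n)%N -> c i <= \sum_(i < n) c i.
Proof.
move=> hi; rewrite (bigD1 (Ordinal hi)) //= lerDl; apply: sumr_ge0 => j _.
exact/ltW/c_gt0.
Qed.

Lemma sum_w_ge0 : 0 <= \sum_(i < n) w i.
Proof. by apply: sumr_ge0 => j _; exact: le_trans (v_ge0 _) (ltW (v_lt_w _)). Qed.

Lemma sum_c_ge0 : 0 <= \sum_(i < n) c i.
Proof. by apply: sumr_ge0 => j _; exact/ltW/c_gt0. Qed.

Lemma radix_ge2 : 2 <= radix.
Proof. by have := sum_w_ge0; have := sum_c_ge0; rewrite /radix; nia. Qed.

Lemma place_gt0 i : 0 < place i.
Proof.
apply: prodr_gt0 => j _; case: ifP => // _; have := radix_ge2; lia.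
Qed.

Lemma perturbed_gt0 i : (i < n)%N -> 0 < perturbed i.
Proof. by move=> /P_ge0 h; rewrite /perturbed ltr_wpDl ?place_gt0 // mulr_ge0 // ltW ?place_gt0.
Qed.

Lemma digit_eq0 a (x m : int) : (a < n)%N -> `|x| < radix ->
  x * place a + radix ^+ a.+1 * m = 0 -> x = 0.
Proof.
move=> ha hx; rewrite placeE ?(ltnW ha) // exprS => h.
have r2 := radix_ge2; have r0 : radix ^+ a != 0 by rewrite expf_neq0 //; lia.
have {}h : radix ^+ a * (x + radix * m) = 0 by rewrite -h; ring.
move: h => /eqP; rewrite mulf_eq0 (negPf r0) /= => /eqP h.
have [m0|m0] := eqVneq m 0; first by move: h; rewrite m0 mulr0 addr0.
by have [m1|m1] : m <= -1 \/ 1 <= m; [lia | nia | nia].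
Qed.

Lemma perturbed_shift a b : (a < b < n)%N -> exists m, perturbed b = radix ^+ a.+1 * m.
Proof.
move=> /andP[ab bn]; exists (radix ^+ (n - a.+1) * P b + radix ^+ (b - a.+1)).
rewrite /perturbed !placeE // ?(ltnW bn) // mulrDr mulrA -!exprD; congr (_ ^+ _ * _ + _ ^+ _); lia.
Qed.

Lemma perturbed_lead a : (a < n)%N -> exists m, perturbed a = radix ^+ a.+1 * m + place a.
Proof.
move=> an; exists (radix ^+ (n - a.+1) * P a).
by rewrite /perturbed placeE // mulrA -!exprD subnKC.
Qed.

(** All terms except x * radix ^ a are divisible by radix ^ (a + 1). *)
Lemma no_relation a b d (x y z : int) : (a < n)%N -> (a < b < n)%N -> (a < d < n)%N ->
  `|x| < radix -> x * perturbed a + y * perturbed b + z * perturbed d = 0 -> x = 0.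
Proof.
move=> an /perturbed_shift[mb ->] /perturbed_shift[md ->] hx.
have [ma ->] := perturbed_lead an => h.
apply: (@digit_eq0 a x (x * ma + y * mb + z * md)) => //.
by rewrite -h; ring.
Qed.

Variable R : realFieldType.
Local Notation rl f := (fun i => (f i)%:~R : R).
Variable z : R * R.

Definition tied (i : nat) : bool :=
  ((perturbed i)%:~R == cheapest (rl w) (rl v) (rl c) i z).

(** The cost of a tied item is the pairing of z with one of its two data vectors. *)
Lemma tied_vector i : (i < n)%N -> tied i -> exists a b : int,
  [/\ 0 <= a <= \sum_(i < n) w i, 0 <= b <= \sum_(i < n) c i, (0 < a) || (0 < b) &
      (perturbed i)%:~R = a%:~R * z.1 + b%:~R * z.2 :> R].
Proof.
move=> hi /eqP; have hw := w_le_sum hi; have hc := c_le_sum hi.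
have v0 := v_ge0 hi; have vw := v_lt_w hi; have c0 := c_gt0 hi.
rewrite /cheapest /Order.min; case: ifP => _ ->.
  exists (w i), 0; split; [lia | by rewrite lexx sum_c_ge0 | lia |].
  by rewrite mul0r addr0 mulrC.
exists (v i), (c i); split; [lia | lia | lia |].
by rewrite [z.1 * _]mulrC [z.2 * _]mulrC.
Qed.

(** Two parallel data vectors would make a multiple of one perturbed profit equal to a
    multiple of the other. *)
Lemma tied_independent i j a b a' b' : (i < j < n)%N ->
  0 <= a <= \sum_(i < n) w i -> 0 <= b <= \sum_(i < n) c i ->
  0 <= a' <= \sum_(i < n) w i -> 0 <= b' <= \sum_(i < n) c i -> (0 < a') || (0 < b') ->
  (perturbed i)%:~R = a%:~R * z.1 + b%:~R * z.2 :> R ->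
  (perturbed j)%:~R = a'%:~R * z.1 + b'%:~R * z.2 :> R ->
  a * b' - a' * b != 0.
Proof.
move=> /andP[ij jn] ha hb ha' hb' pos ei ej; apply/negP => /eqP cross.
have hin := ltn_trans ij jn.
have sw := sum_w_ge0; have sc := sum_c_ge0.
have rel (x y : int) : x * a = y * a' -> x * b = y * b' ->
    x * perturbed i + - y * perturbed j + 0 * perturbed j = 0.
  move=> h1 h2; apply/eqP; rewrite -(@intr_eq0 R) mul0r addr0 mulNr intrB !intrM ei ej.
  rewrite !mulrDr !mulrA -!intrM h1 h2; apply/eqP; ring.
have h1 : (i < j < n)%N by rewrite ij.
have [b0|b0] := ltP 0 b'.
  have := no_relation hin h1 h1 _ (rel b' b _ _).
  have hr : `|b'| < radix by rewrite /radix; nia.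
  by move=> /(_ hr); have e1 : b' * a = b * a' by [lia | nia]; move=> /(_ e1 (mulrC _ _)); lia.
have a0 : 0 < a' by move: pos; rewrite [0 < b']ltNge b0 orbF.
have := no_relation hin h1 h1 _ (rel a' a (mulrC _ _) _).
have hr : `|a'| < radix by rewrite /radix; nia.
by move=> /(_ hr); have e1 : a' * b = a * b' by [lia | nia]; move=> /(_ e1); lia.
Qed.

Lemma not_three_tied_ordered i j k : (i < j < n)%N -> (i < k < n)%N -> j != k ->
  tied i -> tied j -> tied k -> False.
Proof.
move=> hij hik jk /tied_vector ti /tied_vector tj /tied_vector tk.
have [/ltnW hj hj'] := andP hij; have [_ hk'] := andP hik.
have hi' : (i < n)%N by apply: leq_ltn_trans hj hj'.
have [a [b [ha hb hp ei]]] := ti hi'.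
have [a' [b' [ha' hb' hp' ej]]] := tj hj'.
have [a'' [b'' [ha'' hb'' hp'' ek]]] := tk hk'.
have x0 : a' * b'' - a'' * b' != 0.
  case: (ltngtP j k) => [h|h|h].
  - by apply: (@tied_independent j k) => //; rewrite h.
  - rewrite -oppr_eq0 opprB; apply: (@tied_independent k j) => //; rewrite ?h //.
  - by rewrite h eqxx in jk.
have /eqP := x0; apply;
  apply: (no_relation hi' hij hik (y := a'' * b - a * b'') (z := a * b' - a' * b)).
  have sw := sum_w_ge0; have sc := sum_c_ge0.
  by rewrite /radix; nia.
apply/eqP; rewrite -(@intr_eq0 R) !intrD !intrM ei ej ek !intrB !intrM; apply/eqP; ring.
Qed.

(** Three vectors in the plane satisfy a linear relation whose coefficients are their 2 x 2
    determinants, and the perturbed profits of tied items satisfy the same relation. *)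
Lemma card_tied : (#|[set i : 'I_n | tied i]| <= 2)%N.
Proof.
rewrite leqNgt; apply/negP => /card_gt2P[i [j [k [[]]]]].
rewrite !inE => ti tj tk [] ij jk ki.
have ltn i' := ltn_ord (i' : 'I_n).
case: (ltngtP i j) ij => [h1|h1|/val_inj ->] ij; last by rewrite eqxx in ij.
  case: (ltngtP i k) ki => [h2|h2|/val_inj ->] ki; last by rewrite eqxx in ki.
    by apply: (@not_three_tied_ordered i j k); rewrite ?h1 ?h2 ?ltn.
  by apply: (@not_three_tied_ordered k i j); rewrite ?h2 ?(ltn_trans h2 h1) ?ltn.
case: (ltngtP j k) jk => [h2|h2|/val_inj ->] jk; last by rewrite eqxx in jk.
  by apply: (@not_three_tied_ordered j i k); rewrite ?h1 ?h2 ?ltn // eq_sym.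
by apply: (@not_three_tied_ordered k i j); rewrite ?h2 ?(ltn_trans h2 h1) ?ltn.
Qed.
End Perturbation.

(** * Integer data: rounding loses at most two items *)

Section Cast.
Variables (R : realFieldType) (n : nat) (p w v c : nat -> int).
Local Notation rl f := (fun i => (f i)%:~R : R).

Lemma line_fst_intr j tau : (line_fst n w v j tau)%:~R = line_fst n (rl w) (rl v) j tau :> R.
Proof. by rewrite /line_fst; do ?case: ifP => _ //; rewrite ?intrB //; case: eqP. Qed.

Lemma line_snd_intr j tau : (line_snd n c j tau)%:~R = line_snd n (rl c) j tau :> R.
Proof. by rewrite /line_snd; do ?case: ifP => _ //; rewrite ?intrN //; case: eqP. Qed.

Lemma line_rhs_intr j tau : (line_rhs n p j tau)%:~R = line_rhs n (rl p) j tau :> R.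
Proof. by rewrite /line_rhs; case: ifP. Qed.

Lemma meet_det_intr l1 l2 : (meet_det n w v c l1 l2)%:~R = meet_det n (rl w) (rl v) (rl c) l1 l2
  :> R.
Proof. by rewrite /meet_det intrB !intrM !line_fst_intr !line_snd_intr. Qed.

Lemma meet_fst_intr l1 l2 : (meet_fst n p c l1 l2)%:~R = meet_fst n (rl p) (rl c) l1 l2 :> R.
Proof. by rewrite /meet_fst intrB !intrM !line_rhs_intr !line_snd_intr. Qed.

Lemma meet_snd_intr l1 l2 : (meet_snd n p w v l1 l2)%:~R = meet_snd n (rl p) (rl w) (rl v) l1 l2
  :> R.
Proof. by rewrite /meet_snd intrB !intrM !line_rhs_intr !line_fst_intr. Qed.

Lemma intr_min (a b : int) : (Num.min a b)%:~R = Num.min a%:~R b%:~R :> R.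
Proof. by rewrite /Order.min ltr_int; case: ifP. Qed.
End Cast.

Section Approximation.
Variables (R : realFieldType) (n : nat) (P w v c : nat -> int) (B C : int).
Variables (G S : pred nat) (M : int).
Hypothesis P_ge0 : forall i, (i < n)%N -> 0 <= P i.
Hypothesis v_ge0 : forall i, (i < n)%N -> 0 <= v i.
Hypothesis v_lt_w : forall i, (i < n)%N -> v i < w i.
Hypothesis c_gt0 : forall i, (i < n)%N -> 0 < c i.
Hypothesis B_ge0 : 0 <= B.
Hypothesis C_ge0 : 0 <= C.
Hypothesis S_free : forall i, S i -> ~~ G i.
Hypothesis M_ge0 : 0 <= M.
Hypothesis S_le : forall i, (i < n)%N -> S i -> P i <= M.

Local Notation rl f := (fun i => (f i)%:~R : R).
Local Notation pp := (perturbed n P w c).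
Local Notation pt := (meet_point n (rl pp) (rl w) (rl v) (rl c)).

Lemma profitableE l1 l2 i : meet_det n w v c l1 l2 != 0 ->
  profitable n P w v c l1 l2 i = (cheapest (rl w) (rl v) (rl c) i (pt l1 l2) < (pp i)%:~R).
Proof.
move=> hd; rewrite /profitable /cheapest gt_min.
set s := orient _ _ _ _ _ _; set d := meet_det _ _ _ _ _ _ in hd *.
have sd : 0 < s * d.
  rewrite /s /orient -/d; case: (ltP 0 d) => [h|]; first by rewrite mul1r.
  by rewrite le_eqVlt (negPf hd) mulN1r oppr_gt0.
have sR : 0 < (s * d)%:~R :> R by rewrite ltr0z.
have dR : d%:~R != 0 :> R by rewrite intr_eq0.
rewrite -(ltr_int R) -[X in _ = X || _](ltr_pM2r sR).
rewrite -[X in _ || X](ltr_int R) -[X in _ = _ || X](ltr_pM2r sR).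
rewrite /meet_point -meet_det_intr -meet_fst_intr -meet_snd_intr -/d /=.
move: (meet_fst _ _ _ _ _) (meet_snd _ _ _ _ _ _) (pp i) sd sR => f1 f2 q sd sR.
clearbody s d.
by congr (_ || _); rewrite ?intrD !intrM; congr (_ < _); field.
Qed.

Lemma sum_place_lt : \sum_(i < n) place n w c i < place n w c n.
Proof.
rewrite placeE //; have r2 := radix_ge2 v_ge0 v_lt_w c_gt0.
rewrite (eq_bigr (fun i : 'I_n => radix n w c ^+ i)); last first.
  by move=> i _; rewrite placeE // ltnW.
move: (radix n w c) r2 => r r2; elim: (n) => [|k IH]; first by rewrite big_ord0 expr0.
have rk : 0 < r ^+ k by rewrite exprn_gt0 //; lia.
rewrite exprS; have -> : \sum_(i < k.+1) r ^+ i = \sum_(i < k) r ^+ i + r ^+ k by rewrite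
  big_ord_recr.
by move: (\sum_(i < k) _) (r ^+ k) IH rk => s1 s2 IH rk; nia.
Qed.

(** The perturbations add up to less than one unit of the scaled profits, so they do not
    affect an inequality between integers. *)
Lemma perturbed_compare (x : 'I_n -> bool) (T : pred 'I_n) :
  \sum_(i < n | S i) pp i * (x i)%:R <= \sum_(i < n | T i) pp i ->
  \sum_(i < n | S i) P i * (x i)%:R <= \sum_(i < n | T i) P i.
Proof.
move=> h; have q0 := place_gt0 v_ge0 v_lt_w c_gt0.
have hT : \sum_(i < n | T i) pp i < place n w c n * (\sum_(i < n | T i) P i + 1).
  rewrite mulrDr mulr1 mulr_sumr big_split /= ltrD2l; apply: le_lt_trans sum_place_lt.
  by rewrite [X in _ <= X](bigID T) /= lerDl sumr_ge0 // => i _; exact/ltW/q0.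
have hS : place n w c n * (\sum_(i < n | S i) P i * (x i)%:R) <= \sum_(i < n | S i) pp i * (x i)%:R.
  rewrite mulr_sumr; apply: ler_sum => i _; rewrite mulrA ler_wpM2r //.
  by rewrite /perturbed lerDl ltW.
have := le_lt_trans hS (le_lt_trans h hT).
by rewrite ltr_pM2l // ltzD1.
Qed.

(** Only the items of S that are tied at the minimiser are lost against (x, y); there are at
    most two, and M bounds the profit of each. *)
Lemma rounding (x : 'I_n -> bool) (y : 'I_n -> R) :
  (forall i, 0 <= y i <= (x i)%:R) ->
  \sum_(i < n) (w i)%:~R * (x i)%:R - \sum_(i < n) (w i - v i)%:~R * y i <= B%:~R ->
  \sum_(i < n) (c i)%:~R * y i <= C%:~R ->
  (forall i : 'I_n, G i -> x i) -> (forall i : 'I_n, x i -> G i || S i) ->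
  exists j1 k1 j2 k2 t, [/\ [/\ (j1 < n + 3)%N, (k1 < n + 3)%N, (j2 < n + 3)%N, (k2 < n + 3)%N
      & (t < n + 3)%N],
    fits n w v c B C (fun i => G i || S i && profitable n P w v c (j1, k1) (j2, k2) i) t
    & \sum_(i < n) P i * (x i)%:R <=
      \sum_(i < n | G i || S i && profitable n P w v c (j1, k1) (j2, k2) i) P i + 2 * M].
Proof.
move=> hy hB hC hG hx.
have p0 i : (i < n)%N -> 0 <= (pp i)%:~R :> R.
  by move=> hi; rewrite ler0z ltW // (perturbed_gt0 P_ge0 v_ge0 v_lt_w c_gt0).
have v0 i : (i < n)%N -> 0 <= (v i)%:~R :> R by move=> hi; rewrite ler0z v_ge0.
have vw i : (i < n)%N -> (v i)%:~R < (w i)%:~R :> R by move=> hi; rewrite ltr_int v_lt_w.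
have c0 i : (i < n)%N -> 0 < (c i)%:~R :> R by move=> hi; rewrite ltr0z c_gt0.
have hB' : \sum_(i < n) (w i)%:~R * (x i)%:R - \sum_(i < n) ((w i)%:~R - (v i)%:~R) * y i <= B%:~R.
  by move: hB; under [X in _ - X <= _]eq_bigr => i _ do rewrite intrB.
have weak z : nonneg z -> \sum_(i < n | S i) (pp i)%:~R * (x i)%:R <=
     dual n (rl pp) (rl w) (rl v) (rl c) B%:~R C%:~R G S z.
  by move=> hz; exact: (weak_duality _ v0 vw c0 S_free hz hy hB' hC hG hx).
have dual0 z : nonneg z -> 0 <= dual n (rl pp) (rl w) (rl v) (rl c) B%:~R C%:~R G S z.
  by move=> /weak; apply: le_trans; apply: sumr_ge0 => i _; rewrite mulr_ge0 ?p0.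
(* The point (x, y) is what bounds the dual below. *)
have [l1 [l2 [hdet z0 zmin]]] := dual_minimiser dual0.
have hdet' : meet_det n w v c (pair_of l1) (pair_of l2) != 0.
  by rewrite -(intr_eq0 R) meet_det_intr.
set z := pt _ _ in z0 zmin.
have prof i : profitable n P w v c (pair_of l1) (pair_of l2) i =
    (cheapest (rl w) (rl v) (rl c) i z < (pp i)%:~R) := profitableE i hdet'.
set X := fun i => G i || S i && profitable n P w v c (pair_of l1) (pair_of l2) i.
have [|t ht hfit] := @greedy_fits n w v c B C X v_lt_w c_gt0 B_ge0 C_ge0.
  move=> d1 d2 h1 h2; rewrite -(ler_int R) rmorph_sum intrD !intrM.
  have hd : nonneg (d1%:~R, d2%:~R : R) by rewrite /nonneg /= !ler0z h1.
  apply: le_trans (minimiser_feasible v0 vw c0 S_free z0 zmin hd).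
  rewrite le_eqVlt; apply/orP; left; apply/eqP; apply: eq_big => [i|i _].
    by rewrite /X prof.
  by rewrite /= intr_min /cheapest /= intrD !intrM.
exists (val l1.1), (val l1.2), (val l2.1), (val l2.2), t; split.
- by split; first [exact: ltn_ord | exact: ht].
- exact: hfit.
change (\sum_(i < n) P i * (x i)%:R <= \sum_(i < n | X i) P i + 2 * M).
have := le_trans (weak z z0) (dual_le_taken v0 vw c0 z0 zmin).
set T := fun i : 'I_n => S i && (cheapest (rl w) (rl v) (rl c) i z <= (pp i)%:~R).
move=> hT; have {hT} : \sum_(i < n | S i) pp i * (x i)%:R <= \sum_(i < n | T i) pp i.
  rewrite -(ler_int R) !rmorph_sum; apply: le_trans hT.
  by rewrite le_eqVlt; apply/orP; left; apply/eqP; apply: eq_bigr => i _; rewrite /= intrM;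
    case: (x i).
move/perturbed_compare => main.
pose Q := fun i : nat => S i && profitable n P w v c (pair_of l1) (pair_of l2) i.
have E1 : \sum_(i < n) P i * (x i)%:R <=
    \sum_(i < n | G i) P i + \sum_(i < n | S i) P i * (x i)%:R.
  rewrite (big_mkcond (fun i : 'I_n => G i)) (big_mkcond (fun i : 'I_n => S i)) -big_split.
  apply: ler_sum => i _ /=; have Pi := P_ge0 (ltn_ord i); move: (hG i) (hx i).
  by case: (G i); case: (S i); case: (x i) => //= h1 h2;
    rewrite ?mulr1 ?mulr0 ?addr0 ?add0r ?lerDl //;
    case: (notF (h2 isT)).
have E2 : \sum_(i < n | G i) P i + \sum_(i < n | Q i) P i <= \sum_(i < n | X i) P i.
  rewrite (big_mkcond (fun i : 'I_n => G i)) (big_mkcond (fun i : 'I_n => Q i)).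
  rewrite (big_mkcond (fun i : 'I_n => X i)) -big_split.
  apply: ler_sum => i _ /=; rewrite /X /Q; move: (@S_free i).
  by case: (S i) => [/(_ isT)/negPf ->|_] /=; rewrite ?add0r ?orbF ?addr0.
have E3 : \sum_(i < n | T i) P i <= \sum_(i < n | Q i) P i + 2 * M.
  rewrite (bigID (fun i : 'I_n => Q i)) /=; apply: lerD.
    rewrite le_eqVlt; apply/orP; left; apply/eqP; apply: eq_bigl => i.
    by rewrite /T /Q prof; case: (S i) => //=; case: ltP => [/ltW ->|]; rewrite ?andbF.
  apply: (@le_trans _ _ (\sum_(i < n | T i && ~~ Q i) M)).
    by apply: ler_sum => i /andP[/andP[Si _] _]; exact: S_le.
  rewrite sumr_const -[M *+ _]mulr_natl ler_wpM2r // ler_nat.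
  apply: leq_trans _ (card_tied P v_ge0 v_lt_w c_gt0 z).
  apply/subset_leq_card/subsetP => i; rewrite inE unfold_in /T /Q prof /tied.
  by case: (S i) => //=; rewrite -leNgt => /andP[h1 h2]; rewrite eq_le h1 h2.
lia.
Qed.
End Approximation.

(** * More closure properties of computable functions *)

Definition computable_nat (l : nat) (f : instance -> seq nat -> nat) : Prop :=
  computable l (fun I e => (f I e)%:Z).
Definition computable_bool (l : nat) (b : instance -> seq nat -> bool) : Prop :=
  computable_nat l (fun I e => b I e : nat).

Lemma computable_if l b f g : computable_bool l b -> computable l f -> computable l g ->
  computable l (fun I e => if b I e then f I e else g I e).
Proof.
move=> hb hf hg; have h1 := computable_mul hb hf.
have h2 := computable_mul (computable_sub (computable_const l 1) hb) hg.
apply: computable_ext (computable_add h1 h2) => I e _.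
by case: (b I e); rewrite ?mul1r ?mul0r ?subrr ?subr0 ?mul0r ?mul1r ?addr0 ?add0r.
Qed.

Lemma computable_bool_ext l b b' : (forall I e, size e = l -> b I e = b' I e) ->
  computable_bool l b -> computable_bool l b'.
Proof. by move=> h; apply: computable_ext => I e he; rewrite h. Qed.

Lemma computable_lt l f g : computable l f -> computable l g ->
  computable_bool l (fun I e => f I e < g I e).
Proof.
move=> hf hg; apply: computable_ext (computable_pos (computable_sub hg hf)) => I e _.
by rewrite subr_gt0.
Qed.

Lemma computable_not l b : computable_bool l b -> computable_bool l (fun I e => ~~ b I e).
Proof.
move=> hb; apply: computable_ext (computable_sub (computable_const l 1) hb) => I e _.
by case: (b I e).
Qed.

Lemma computable_and l b b' : computable_bool l b -> computable_bool l b' ->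
  computable_bool l (fun I e => b I e && b' I e).
Proof.
move=> h h'; apply: computable_ext (computable_mul h h') => I e _.
by case: (b I e); case: (b' I e).
Qed.

Lemma computable_or l b b' : computable_bool l b -> computable_bool l b' ->
  computable_bool l (fun I e => b I e || b' I e).
Proof.
move=> h h'; have := computable_not (computable_and (computable_not h) (computable_not h')).
by apply: computable_bool_ext => I e _; rewrite negb_and !negbK.
Qed.

Lemma computable_implies l b b' : computable_bool l b -> computable_bool l b' ->
  computable_bool l (fun I e => b I e ==> b' I e).
Proof.
move=> h h'; apply: computable_bool_ext (computable_or (computable_not h) h') => I e _.
by rewrite implybE.
Qed.

Lemma computable_le l f g : computable l f -> computable l g ->
  computable_bool l (fun I e => f I e <= g I e).
Proof.
move=> hf hg; apply: computable_bool_ext (computable_not (computable_lt hg hf)) => I e _.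
by rewrite -leNgt.
Qed.

Lemma computable_eq l f g : computable l f -> computable l g ->
  computable_bool l (fun I e => f I e == g I e).
Proof.
move=> hf hg; have := computable_and (computable_le hf hg) (computable_le hg hf).
by apply: computable_bool_ext => I e _; rewrite -eq_le.
Qed.

Lemma computable_ltn l f g : computable_nat l f -> computable_nat l g ->
  computable_bool l (fun I e => (f I e < g I e)%N).
Proof. by move=> hf hg; apply: computable_bool_ext (computable_lt hf hg). Qed.

Lemma computable_leqn l f g : computable_nat l f -> computable_nat l g ->
  computable_bool l (fun I e => (f I e <= g I e)%N).
Proof. by move=> hf hg; apply: computable_bool_ext (computable_le hf hg). Qed.

Lemma computable_eqn l f g : computable_nat l f -> computable_nat l g ->
  computable_bool l (fun I e => f I e == g I e).
Proof. by move=> hf hg; apply: computable_bool_ext (computable_eq hf hg). Qed.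

Lemma computable_min l f g : computable l f -> computable l g ->
  computable l (fun I e => Num.min (f I e) (g I e)).
Proof. by move=> hf hg; apply: computable_if => //; apply: computable_lt. Qed.

Lemma computable_addn l f g : computable_nat l f -> computable_nat l g ->
  computable_nat l (fun I e => (f I e + g I e)%N).
Proof. by move=> hf hg; apply: computable_ext (computable_add hf hg) => I e _; rewrite PoszD. Qed.

Lemma computable_muln l f g : computable_nat l f -> computable_nat l g ->
  computable_nat l (fun I e => (f I e * g I e)%N).
Proof. by move=> hf hg; apply: computable_ext (computable_mul hf hg) => I e _; rewrite PoszM. Qed.

Lemma computable_divn l f g : computable_nat l f -> computable_nat l g ->
  computable_nat l (fun I e => (f I e %/ g I e)%N).
Proof. by move=> hf hg; apply: computable_ext (computable_div hf hg) => I e _; rewrite divz_nat.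
Qed.

Lemma computable_modn l f g : computable_nat l f -> computable_nat l g ->
  computable_nat l (fun I e => (f I e %% g I e)%N).
Proof.
move=> hf hg; have := computable_sub hf (computable_muln (computable_divn hf hg) hg).
apply: computable_ext => I e _; have := divn_eq (f I e) (g I e); lia.
Qed.

Lemma computable_constn l k : computable_nat l (fun _ _ => k).
Proof. exact: computable_const. Qed.

Lemma computable_expn l f k : computable_nat l f -> computable_nat l (fun I e => (f I e ^ k)%N).
Proof.
move=> hf; elim: k => [|k IH]; first exact: computable_constn.
by apply: computable_ext (computable_muln hf IH) => I e _; rewrite expnS.
Qed.

Lemma computable_nitems l : computable_nat l (fun I _ => nitems I).
Proof. exact: (computable_code (f := fun _ _ => 0%N) (computable_const l 0)). Qed.

Lemma computable_sum_if u b k l N P F :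
  (forall I, N I = ((u * nitems I + b) ^ k)%N) ->
  computable_bool l.+1 (fun I e => P I (behead e) (head 0%N e)) ->
  computable l.+1 (fun I e => F I (behead e) (head 0%N e)) ->
  computable l (fun I e => \sum_(i < N I | P I e i) F I e i).
Proof.
move=> hN hP hF.
apply: (computable_ext (f := fun I e => \sum_(i < N I) if P I e i then F I e i else 0)).
  by move=> I e _; rewrite -big_mkcond.
apply: (computable_sum (F := fun I e i => if P I e i then F I e i else 0) hN).
by apply: computable_if => //; exact: computable_const.
Qed.

Lemma nitems_bound I : nitems I = ((1 * nitems I + 0) ^ 1)%N.
Proof. by rewrite mul1n addn0 expn1. Qed.

Lemma computable_has u b k l (N : instance -> nat) P :
  (forall I, N I = ((u * nitems I + b) ^ k)%N) ->
  computable_bool l.+1 (fun I e => P I (behead e) (head 0%N e)) ->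
  computable_bool l (fun I e => has (P I e) (iota 0 (N I))).
Proof.
move=> hN hP; have := computable_pos (computable_sum (F := fun I e i => (P I e i : nat)%:Z) hN hP).
apply: computable_bool_ext => I e _; rewrite -(big_morph Posz PoszD (erefl _)) ltz_nat.
rewrite lt0n sum_nat_eq0 negb_forall.
apply/existsP/hasP => [[i hi]|[i]].
  exists (val i); first by rewrite mem_iota /=.
  by move: hi; rewrite /=; case: (P I e i).
by rewrite mem_iota add0n => /= hi hP'; exists (Ordinal hi); rewrite /= hP'.
Qed.

Lemma computable_has_list l (P : nat -> instance -> seq nat -> bool) s :
  (forall j, computable_bool l (P j)) ->
  computable_bool l (fun I e => has (fun j => P j I e) s).
Proof.
move=> hP; elim: s => [|j s IH] /=; first exact: computable_constn.
exact: computable_or.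
Qed.

Lemma computable_all_list l (P : nat -> instance -> seq nat -> bool) s :
  (forall j, computable_bool l (P j)) ->
  computable_bool l (fun I e => all (fun j => P j I e) s).
Proof.
move=> hP; elim: s => [|j s IH] /=; first exact: (computable_constn l 1).
exact: computable_and.
Qed.

(** Turns a search into a sum, since sums are what programs are known to compute: the
    positions before the first hit are those with no hit up to them. *)
Lemma find_as_sum (p : pred nat) N :
  find p (iota 0 N) = (\sum_(T < N) ~~ has (fun U => (U <= T) && p U) (iota 0 N))%N.
Proof.
set f := find _ _.
have fN : (f <= N)%N by rewrite -[X in (_ <= X)%N](size_iota 0 N) find_size.
rewrite (eq_bigr (fun T : 'I_N => (T < f)%N : nat)); last first.
  move=> T _; congr nat_of_bool; rewrite ltnNge; congr negb.
  apply/hasP/idP => [[U]|hf].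
    rewrite mem_iota add0n => /= UN /andP[UT pU]; apply: leq_trans UT; rewrite leqNgt.
    by apply/negP => /(before_find 0%N); rewrite nth_iota // add0n pU.
  have fN' : (f < N)%N := leq_ltn_trans hf (ltn_ord T).
  exists f; first by rewrite mem_iota.
  have hp : has p (iota 0 N) by rewrite has_find size_iota.
  by rewrite hf /=; have := nth_find 0%N hp; rewrite -/f nth_iota.
rewrite -big_mkcond /= sum1_card -[LHS]card_ord -sum1_card -sum1_card.
by rewrite (big_ord_narrow fN).
Qed.

Lemma computable_find u b k l (N : instance -> nat) P :
  (forall I, N I = ((u * nitems I + b) ^ k)%N) ->
  (forall l' i, computable_nat l' i -> computable_bool l' (fun I e => P I (i I e))) ->
  computable_nat l (fun I e => find (P I) (iota 0 (N I))).
Proof.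
move=> hN hP.
have h1 l' T : computable_nat l' T ->
    computable_bool l' (fun I e => ~~ has (fun U => (U <= T I e)%N && P I U) (iota 0 (N I))).
  move=> hT; apply: computable_not;
    apply: (computable_has (P := fun I e U => (U <= T I e)%N && P I U) hN).
  apply: computable_and; last exact: (hP _ _ (computable_head l')).
  exact: (computable_leqn (computable_head l') (computable_weaken hT)).
have := computable_sum (F := fun I e T =>
   ((~~ has (fun U => (U <= T)%N && P I U) (iota 0 (N I)) : bool) : nat)%:Z) hN (h1 l.+1 _
     (computable_head l)).
by apply: computable_ext => I e _; rewrite find_as_sum (big_morph Posz PoszD (erefl _)).
Qed.

(** * The algorithm as a computable function *)

(** The quantification over index functions lets the item be the result of an earlier
    computation, such as a digit of the candidate. *)
Definition computable_data (w : instance -> nat -> int) : Prop :=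
  forall l j, computable_nat l j -> computable l (fun I e => w I (j I e)).

Section Parts.
Variables P w v c : instance -> nat -> int.
Hypotheses (hP : computable_data P) (hw : computable_data w).
Hypotheses (hv : computable_data v) (hc : computable_data c).

Lemma computable_data_sum l (d : instance -> nat -> int) : computable_data d ->
  computable l (fun I e => \sum_(i < nitems I) d I i).
Proof.
move=> hd; apply: (computable_sum (F := fun I e i => d I i) nitems_bound).
exact: hd (computable_head l).
Qed.

Lemma computable_radix l : computable l (fun I e => radix (nitems I) (w I) (c I)).
Proof.
have h1 := computable_const l 1.
apply: computable_add => //; apply: computable_mul; apply: computable_add => //;
exact: computable_data_sum.
Qed.

Lemma computable_place l i : computable_nat l i ->
  computable l (fun I e => place (nitems I) (w I) (c I) (i I e)).
Proof.
move=> hi; apply: (computable_prod (F := fun I e j =>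
  if (j < i I e)%N then radix (nitems I) (w I) (c I) else 1) nitems_bound).
apply: computable_if; last exact: computable_const.
  by apply: computable_ltn; [exact: computable_head | exact: (computable_weaken hi)].
exact: computable_radix.
Qed.

Lemma computable_perturbed : computable_data (fun I => perturbed (nitems I) (P I) (w I) (c I)).
Proof.
move=> l i hi; apply: computable_add; last exact: computable_place.
by apply: computable_mul; [apply: computable_place; exact: computable_nitems | exact: hP].
Qed.

Lemma computable_line_fst l j tau : computable_nat l j -> computable_nat l tau ->
  computable l (fun I e => line_fst (nitems I) (w I) (v I) (j I e) (tau I e)).
Proof.
move=> hj ht; apply: computable_if.
- by apply: computable_ltn => //; exact: computable_nitems.
- apply: computable_if; first by apply: computable_eqn => //; exact: computable_constn.
    exact: hw.
  apply: computable_if; first by apply: computable_eqn => //; exact: computable_constn.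
    exact: hv.
  by apply: computable_sub; [exact: hw | exact: hv].
- apply: (computable_ext (f := fun I e => if tau I e == 0%N then 1 else 0)).
    by move=> I e _; case: eqP.
  apply: computable_if; [|exact: computable_const..].
  by apply: computable_eqn => //; exact: computable_constn.
Qed.

Lemma computable_line_snd l j tau : computable_nat l j -> computable_nat l tau ->
  computable l (fun I e => line_snd (nitems I) (c I) (j I e) (tau I e)).
Proof.
move=> hj ht; apply: computable_if.
- by apply: computable_ltn => //; exact: computable_nitems.
- apply: computable_if; [|exact: computable_const|].
    by apply: computable_eqn => //; exact: computable_constn.
  apply: computable_if; first by apply: computable_eqn => //; exact: computable_constn.
    exact: hc.
  apply: computable_ext (computable_sub (computable_const l 0) (hc hj)) => I e _.
  by rewrite sub0r.
- apply: (computable_ext (f := fun I e => if tau I e == 0%N then 0 else 1)).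
    by move=> I e _; case: eqP.
  apply: computable_if; [|exact: computable_const..].
  by apply: computable_eqn => //; exact: computable_constn.
Qed.

Lemma computable_line_rhs l j tau (p : instance -> nat -> int) : computable_data p ->
  computable_nat l j -> computable_nat l tau ->
  computable l (fun I e => line_rhs (nitems I) (p I) (j I e) (tau I e)).
Proof.
move=> hp hj ht; apply: computable_if; [|exact: hp|exact: computable_const].
by apply: computable_and; apply: computable_ltn => //;
  [exact: computable_nitems | exact: computable_constn].
Qed.

Section Meet.
Variables (l : nat) (j1 k1 j2 k2 : instance -> seq nat -> nat).
Hypotheses (hj1 : computable_nat l j1) (hk1 : computable_nat l k1).
Hypotheses (hj2 : computable_nat l j2) (hk2 : computable_nat l k2).

Let fst1 := computable_line_fst hj1 hk1.
Let fst2 := computable_line_fst hj2 hk2.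
Let snd1 := computable_line_snd hj1 hk1.
Let snd2 := computable_line_snd hj2 hk2.
Let rhs1 := computable_line_rhs computable_perturbed hj1 hk1.
Let rhs2 := computable_line_rhs computable_perturbed hj2 hk2.

Lemma computable_profitable i : computable_nat l i ->
  computable_bool l (fun I e => profitable (nitems I) (P I) (w I) (v I) (c I)
    (j1 I e, k1 I e) (j2 I e, k2 I e) (i I e)).
Proof.
move=> hi.
have hd : computable l (fun I e => meet_det (nitems I) (w I) (v I) (c I)
    (j1 I e, k1 I e) (j2 I e, k2 I e)).
  exact: computable_sub (computable_mul fst1 snd2) (computable_mul fst2 snd1).
have h1 : computable l (fun I e => meet_fst (nitems I) (perturbed (nitems I) (P I) (w I) (c I))
    (c I) (j1 I e, k1 I e) (j2 I e, k2 I e)).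
  exact: computable_sub (computable_mul rhs1 snd2) (computable_mul rhs2 snd1).
have h2 : computable l (fun I e => meet_snd (nitems I) (perturbed (nitems I) (P I) (w I) (c I))
    (w I) (v I) (j1 I e, k1 I e) (j2 I e, k2 I e)).
  exact: computable_sub (computable_mul fst1 rhs2) (computable_mul fst2 rhs1).
have hs : computable l (fun I e => orient (nitems I) (w I) (v I) (c I)
    (j1 I e, k1 I e) (j2 I e, k2 I e)).
  apply: computable_if; [|exact: computable_const..].
  by apply: computable_lt => //; exact: computable_const.
have hp := computable_perturbed hi.
apply: computable_or; apply: computable_lt; try by apply: computable_mul => //;
  exact: computable_mul.
  by apply: computable_mul; [exact: hw | exact: computable_mul].
by apply: computable_add; apply: computable_mul;
  [exact: hv | exact: computable_mul | exact: hc | exact: computable_mul].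
Qed.
End Meet.

Section Greedy.
Variables (B C : instance -> int) (X : instance -> seq nat -> pred nat) (l : nat).
Variable t : instance -> seq nat -> nat.
Hypothesis hB : computable l (fun I e => B I).
Hypothesis hC : computable l (fun I e => C I).
Hypothesis hX : computable_bool l.+1 (fun I e => X I (behead e) (head 0%N e)).
Hypothesis ht : computable_nat l t.

Lemma computable_steeper t' l' i : computable_nat l' t' -> computable_nat l' i ->
  computable_bool l' (fun I e => steeper (w I) (v I) (c I) (t' I e) (i I e)).
Proof.
move=> ht' hi; apply: computable_lt; apply: computable_mul; try exact: hc;
by apply: computable_sub; [exact: hw | exact: hv].
Qed.

Lemma computable_level t' l' i : computable_nat l' t' -> computable_nat l' i ->
  computable_bool l' (fun I e => level (w I) (v I) (c I) (t' I e) (i I e)).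
Proof.
move=> ht' hi; apply: computable_eq; apply: computable_mul; try exact: hc;
by apply: computable_sub; [exact: hw | exact: hv].
Qed.

Lemma computable_steeper_cost :
  computable l (fun I e => steeper_cost (nitems I) (w I) (v I) (c I) (X I e) (t I e)).
Proof.
apply: (computable_sum_if (P := fun I e i => X I e i && steeper (w I) (v I) (c I) (t I e) i)
  (F := fun I e i => c I i) nitems_bound).
  apply: computable_and => //;
    exact: (computable_steeper (computable_weaken ht) (computable_head l)).
exact: hc (computable_head l).
Qed.

Lemma computable_level_cost :
  computable l (fun I e => level_cost (nitems I) (w I) (v I) (c I) (X I e) (t I e)).
Proof.
apply: (computable_sum_if (P := fun I e i => X I e i && level (w I) (v I) (c I) (t I e) i)
  (F := fun I e i => c I i) nitems_bound).
  apply: computable_and => //; exact: (computable_level (computable_weaken ht) (computable_head l)).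
exact: hc (computable_head l).
Qed.

Lemma computable_y_den :
  computable l (fun I e => y_den (nitems I) (w I) (v I) (c I) (X I e) (t I e)).
Proof.
apply: computable_if; [|exact: computable_level_cost|exact: computable_const].
by apply: computable_lt; [exact: computable_const|exact: computable_level_cost].
Qed.

Lemma computable_y_cut :
  computable l (fun I e => y_cut (nitems I) (w I) (v I) (c I) (C I) (X I e) (t I e)).
Proof.
apply: computable_min; first exact: computable_y_den.
by apply: computable_sub => //; exact: computable_steeper_cost.
Qed.

Lemma computable_y_num :
  computable l.+1 (fun I e => y_num (nitems I) (w I) (v I) (c I) (C I)
    (X I (behead e)) (t I (behead e)) (head 0%N e)).
Proof.
have h := computable_head l; have ht' := computable_weaken ht.
apply: computable_if => //; last exact: computable_const.
apply: computable_if; first exact: computable_steeper.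
  exact: (computable_weaken computable_y_den).
apply: computable_if; first exact: computable_level.
  exact: (computable_weaken computable_y_cut).
exact: computable_const.
Qed.

Lemma computable_fits :
  computable_bool l (fun I e => fits (nitems I) (w I) (v I) (c I) (B I) (C I) (X I e) (t I e)).
Proof.
have h := computable_head l.
apply: computable_and; last apply: computable_and.
- apply: computable_le; [exact: computable_const | exact: computable_y_cut].
- apply: computable_le; last by apply: computable_mul => //; exact: computable_y_den.
  apply: (computable_sum (F := fun I e i => c I i * y_num (nitems I) (w I) (v I) (c I) (C I)
    (X I e) (t I e) i) nitems_bound).
  by apply: computable_mul; [exact: hc | exact: computable_y_num].
- apply: computable_le; last by apply: computable_mul => //; exact: computable_y_den.
  apply: computable_sub.
    apply: computable_mul; first exact: computable_y_den.
    apply: (computable_sum_if (P := fun I e i => X I e i) (F :=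
      fun I e i => w I i) nitems_bound) => //.
    exact: hw.
  apply: (computable_sum (F := fun I e i => (w I i - v I i) *
    y_num (nitems I) (w I) (v I) (c I) (C I) (X I e) (t I e) i) nitems_bound).
  apply: computable_mul; last exact: computable_y_num.
  by apply: computable_sub; [exact: hw | exact: hv].
Qed.
End Greedy.
End Parts.

(** A common denominator of all data. Scaling both weights and costs by it leaves y
    unchanged. *)
Definition common_den (I : instance) : int :=
  code I 2 * code I 4 * \prod_(i < nitems I)
    (code I (6 + 8 * i) * code I (8 + 8 * i) * code I (10 + 8 * i) * code I (12 + 8 * i)).
Definition scaled (I : instance) (a : nat) : int :=
  code I a * (common_den I %/ code I (a + 1))%Z.

Definition int_profit (I : instance) (i : nat) := scaled I (5 + 8 * i).
Definition int_weight (I : instance) (i : nat) := scaled I (7 + 8 * i).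
Definition int_improved (I : instance) (i : nat) := scaled I (9 + 8 * i).
Definition int_cost (I : instance) (i : nat) := scaled I (11 + 8 * i).
Definition int_knapsack (I : instance) := scaled I 1.
Definition int_improvement (I : instance) := scaled I 3.

Section Candidates.
Variables (k : nat) (I : instance).

(** A candidate T is read in base n + 3. Its first k digits are the guessed items, where the
    values n, n + 1, n + 2 mean no item; four digits code two lines, and the last one is the
    threshold item. *)
Definition digit (T j : nat) : nat := ((T %/ (nitems I + 3) ^ j) %% (nitems I + 3))%N.
Definition guessed (T i : nat) : bool := has (fun j => digit T j == i) (iota 0 k).
(** In a good guess the guessed items are the most profitable ones of a solution, so no item
    that is added later is worth more than any of them. *)
Definition no_dearer (T i : nat) : bool :=
  all (fun j => (digit T j < nitems I)%N ==> (int_profit I i <= int_profit I (digit T j)))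
    (iota 0 k).
Definition eligible (T i : nat) : bool := ~~ guessed T i && no_dearer T i.
Definition picked (T i : nat) : bool :=
  guessed T i || eligible T i &&
    profitable (nitems I) (int_profit I) (int_weight I) (int_improved I) (int_cost I)
      (digit T k, digit T k.+1) (digit T k.+2, digit T k.+3) i.
Definition threshold (T : nat) : nat := digit T k.+4.
(** One is added so that an admissible candidate without profit still beats a failing one. *)
Definition value (T : nat) : int :=
  if fits (nitems I) (int_weight I) (int_improved I) (int_cost I)
       (int_knapsack I) (int_improvement I) (picked T) (threshold T)
  then 1 + \sum_(i < nitems I | picked T i) int_profit I i else 0.
Definition candidates : nat := ((nitems I + 3) ^ k.+4.+1)%N.
Definition best : nat :=
  find (fun T => ~~ has (fun U => value T < value U) (iota 0 candidates)) (iota 0 candidates).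
(** The contents of register j of the output: j = 3 i + r for item i. *)
Definition answer (j : nat) : int :=
  let i := (j %/ 3)%N in
  if (j %% 3)%N == 0%N then (picked best i : nat)%:Z
  else if (j %% 3)%N == 1%N then
    y_num (nitems I) (int_weight I) (int_improved I) (int_cost I) (int_improvement I)
      (picked best) (threshold best) i
  else y_den (nitems I) (int_weight I) (int_improved I) (int_cost I)
      (picked best) (threshold best).
End Candidates.

Lemma computable_address l a i : computable_nat l i ->
  computable_nat l (fun I e => (a + 8 * i I e)%N).
Proof.
move=> hi; apply: computable_addn; first exact: computable_constn.
by apply: computable_muln => //; exact: computable_constn.
Qed.

Lemma computable_common_den l : computable l (fun I e => common_den I).
Proof.
apply: computable_mul.
  by apply: computable_mul; apply: (computable_code (f := fun _ _ => _)); exact: computable_constn.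
apply: (computable_prod (F := fun I e i => code I (6 + 8 * i) * code I (8 + 8 * i)
  * code I (10 + 8 * i) * code I (12 + 8 * i)) nitems_bound).
have h a := computable_code (computable_address a (computable_head l)).
by do 3! [apply: computable_mul => //]; exact: h.
Qed.

Lemma computable_scaled : computable_data scaled.
Proof.
move=> l a ha; apply: computable_mul; first exact: computable_code.
apply: computable_div; first exact: computable_common_den.
by apply: computable_code; apply: computable_addn => //; exact: computable_constn.
Qed.

Lemma computable_field a : computable_data (fun I i => scaled I (a + 8 * i)).
Proof. by move=> l i hi; apply: computable_scaled; exact: computable_address. Qed.

Lemma computable_digit k l T : computable_nat l T ->
  computable_nat l (fun I e => digit I (T I e) k).
Proof.
move=> hT.
have hb : computable_nat l (fun I e => (nitems I + 3)%N).
  by apply: computable_addn; [exact: computable_nitems | exact: computable_constn].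
by apply: computable_modn => //; apply: computable_divn => //; exact: computable_expn.
Qed.

Section ComputableCandidates.
Variable k : nat.

Lemma computable_guessed l T i : computable_nat l T -> computable_nat l i ->
  computable_bool l (fun I e => guessed k I (T I e) (i I e)).
Proof.
move=> hT hi; apply: (computable_has_list (P := fun j I e => digit I (T I e) j == i I e)) => j.
by apply: computable_eqn => //; exact: computable_digit.
Qed.

Lemma computable_no_dearer l T i : computable_nat l T -> computable_nat l i ->
  computable_bool l (fun I e => no_dearer k I (T I e) (i I e)).
Proof.
move=> hT hi; apply: (computable_all_list (P := fun j I e => (digit I (T I e) j < nitems I)%N ==>
  (int_profit I (i I e) <= int_profit I (digit I (T I e) j)))) => j.
have hd := computable_digit j hT.
apply: computable_implies; first by apply: computable_ltn => //; exact: computable_nitems.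
by apply: computable_le; exact: computable_field.
Qed.

Lemma computable_picked l T i : computable_nat l T -> computable_nat l i ->
  computable_bool l (fun I e => picked k I (T I e) (i I e)).
Proof.
move=> hT hi; have hg := computable_guessed hT hi.
apply: computable_or => //; apply: computable_and.
  by apply: computable_and; [exact: computable_not | exact: computable_no_dearer].
by apply: (computable_profitable (computable_field 5) (computable_field 7) (computable_field 9)
  (computable_field 11)) => //; exact: computable_digit.
Qed.

Lemma computable_budget l a : computable l (fun I e => scaled I a).
Proof. exact: (computable_scaled (computable_constn l a)). Qed.

Lemma computable_picked_head l T : computable_nat l T ->
  computable_bool l.+1 (fun I e => picked k I (T I (behead e)) (head 0%N e)).
Proof. by move=> hT; exact: (computable_picked (computable_weaken hT) (computable_head l)). Qed.

Lemma computable_value l T : computable_nat l T ->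
  computable l (fun I e => value k I (T I e)).
Proof.
move=> hT; have hX := computable_picked_head hT.
apply: computable_if; last exact: computable_const.
  apply: (computable_fits (computable_field 7) (computable_field 9) (computable_field 11)
    (computable_budget l 1) (computable_budget l 3) hX); exact: computable_digit.
apply: computable_add; first exact: computable_const.
apply: (computable_sum_if (P := fun I e => picked k I (T I e)) (F := fun I e => int_profit I)
  nitems_bound hX); exact: (computable_field 5 (computable_head l)).
Qed.

Lemma candidates_bound I : candidates k I = ((1 * nitems I + 3) ^ k.+4.+1)%N.
Proof. by rewrite mul1n. Qed.

Lemma computable_best l : computable_nat l (fun I e => best k I).
Proof.
have h l' T : computable_nat l' T -> computable_bool l' (fun I e =>
    ~~ has (fun U => value k I (T I e) < value k I U) (iota 0 (candidates k I))).
  move=> hT; apply: computable_not.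
  apply: (computable_has (P := fun I e U => value k I (T I e) < value k I U) candidates_bound).
  apply: computable_lt; first exact: (computable_value (computable_weaken hT)).
  exact: (computable_value (computable_head l')).
exact: (computable_find (P := fun I T => ~~ has (fun U => value k I T < value k I U)
  (iota 0 (candidates k I))) l candidates_bound h).
Qed.

Lemma computable_answer : computable 1 (fun I e => answer k I (head 0%N e)).
Proof.
have hj := computable_head 0.
have hm : computable_nat 1 (fun I e => (head 0 e %% 3)%N).
  by apply: computable_modn => //; exact: computable_constn.
have hi : computable_nat 1 (fun I e => (head 0 e %/ 3)%N).
  by apply: computable_divn => //; exact: computable_constn.
have eq3 r : computable_bool 1 (fun I e => (head 0 e %% 3)%N == r).
  by apply: computable_eqn => //; exact: computable_constn.
have hb l := computable_best l.
have ht l : computable_nat l (fun I e => threshold k I (best k I)) := computable_digit k.+4 (hb l).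
pose X := fun I (_ : seq nat) => picked k I (best k I).
have hX l : computable_bool l.+1 (fun I e => X I (behead e) (head 0%N e)) :=
  computable_picked_head (hb l).
have c7 := computable_field 7; have c9 := computable_field 9; have c11 := computable_field 11.
apply: (computable_if (eq3 0%N) (computable_picked (hb 1%N) hi)).
apply: (computable_if (eq3 1%N));
  last exact: (computable_y_den (X := X) c7 c9 c11 (hX 1%N) (ht 1%N)).
apply: computable_if; [exact: (computable_picked (hb 1%N) hi)| |exact: computable_const].
apply: computable_if; [|exact: (computable_y_den (X := X) c7 c9 c11 (hX 1%N) (ht 1%N))|].
  exact: (computable_steeper c7 c9 c11 (ht 1%N) hi).
apply: computable_if; [| |exact: computable_const].
  exact: (computable_level c7 c9 c11 (ht 1%N) hi).
exact: (computable_y_cut (X := X) c7 c9 c11 (computable_budget 1 3) (hX 1%N) (ht 1%N)).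
Qed.
End ComputableCandidates.

(** * Integer data of an instance, digits and guesses *)

Definition item_code (I : instance) (i : 'I_(nitems I)) : seq int :=
  rat_code (profit i) ++ rat_code (weight i) ++ rat_code (improved_weight i)
    ++ rat_code (improvement_cost i).

Lemma nth_flatten8 (T : Type) (F : T -> seq int) (s : seq T) x0 i f :
  (forall x, size (F x) = 8%N) -> (i < size s)%N -> (f < 8)%N ->
  nth 0 (flatten [seq F x | x <- s]) (8 * i + f) = nth 0 (F (nth x0 s i)) f.
Proof.
move=> hF; elim: s i => [|x s IH] [|i] //= hi hf; rewrite nth_cat hF.
  by rewrite muln0 add0n hf.
have -> : (8 * i.+1 + f < 8)%N = false by lia.
by rewrite -IH //; congr nth; lia.
Qed.

Lemma code_item I (i : 'I_(nitems I)) f : (f < 8)%N ->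
  code I (5 + 8 * i + f) = nth 0 (item_code i) f.
Proof.
move=> hf; rewrite -addnA.
rewrite -[LHS]/(nth 0 (flatten [seq item_code i | i <- enum 'I_(nitems I)]) (8 * i + f)).
rewrite (nth_flatten8 (F := @item_code I) i) ?size_enum_ord //.
by rewrite nth_ord_enum.
Qed.

Lemma code_fields I (i : 'I_(nitems I)) :
  [/\ code I (5 + 8 * i) = numq (profit i) /\ code I (6 + 8 * i) = denq (profit i),
      code I (7 + 8 * i) = numq (weight i) /\ code I (8 + 8 * i) = denq (weight i),
      code I (9 + 8 * i) = numq (improved_weight i) /\
        code I (10 + 8 * i) = denq (improved_weight i) &
      code I (11 + 8 * i) = numq (improvement_cost i) /\
        code I (12 + 8 * i) = denq (improvement_cost i)].
Proof.
have h f (hf : (f < 8)%N) : code I (5 + f + 8 * i) = nth 0 (item_code i) f.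
  by rewrite -code_item // addnAC.
by split; split; [exact: (h 0%N) | exact: (h 1%N) | exact: (h 2%N) | exact: (h 3%N)
  | exact: (h 4%N) | exact: (h 5%N) | exact: (h 6%N) | exact: (h 7%N)].
Qed.

Lemma common_den_gt0 I : 0 < common_den I.
Proof.
rewrite /common_den; apply: mulr_gt0; first by apply: mulr_gt0; exact: denq_gt0.
apply: prodr_gt0 => i _; have [[_ ->] [_ ->] [_ ->] [_ ->]] := code_fields i.
by do 3! [apply: mulr_gt0; last exact: denq_gt0]; exact: denq_gt0.
Qed.

Lemma scaledE (R : realFieldType) I a q :
  code I a = numq q -> code I (a + 1) = denq q -> (denq q %| common_den I)%Z ->
  (scaled I a)%:~R = ratr q * (common_den I)%:~R :> R.
Proof.
move=> ha hd /dvdzP[m hm]; rewrite /scaled ha hd hm mulzK ?denq_neq0 //.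
rewrite /ratr !intrM; have : (denq q)%:~R != 0 :> R by rewrite intr_eq0 denq_neq0.
by move=> h; field.
Qed.

Section Scaling.
Variables (R : realFieldType) (I : instance).
Local Notation n := (nitems I).
Local Notation D := ((common_den I)%:~R : R).

Lemma den_dvd_common (i : 'I_n) a : a \in [:: 6; 8; 10; 12]%N ->
  (code I (a + 8 * i) %| common_den I)%Z.
Proof.
move=> ha; apply: dvdz_mull; rewrite (bigD1 i) //=; apply: dvdz_mulr.
move: ha; rewrite !inE => /or4P[] /eqP ->.
- by do 3! [apply: dvdz_mulr].
- by do 2! [apply: dvdz_mulr]; apply: dvdz_mull.
- by apply: dvdz_mulr; apply: dvdz_mull.
- by apply: dvdz_mull.
Qed.

Lemma int_profitE (i : 'I_n) : (int_profit I i)%:~R = ratr (profit i) * D.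
Proof.
have [[h1 h2] _ _ _] := code_fields i.
apply: scaledE; [exact: h1 | by rewrite addn1; exact: h2 |].
by rewrite -h2; exact: (den_dvd_common i (a := 6)).
Qed.

Lemma int_weightE (i : 'I_n) : (int_weight I i)%:~R = ratr (weight i) * D.
Proof.
have [_ [h1 h2] _ _] := code_fields i.
apply: scaledE; [exact: h1 | by rewrite addn1; exact: h2 |].
by rewrite -h2; exact: (den_dvd_common i (a := 8)).
Qed.

Lemma int_improvedE (i : 'I_n) : (int_improved I i)%:~R = ratr (improved_weight i) * D.
Proof.
have [_ _ [h1 h2] _] := code_fields i.
apply: scaledE; [exact: h1 | by rewrite addn1; exact: h2 |].
by rewrite -h2; exact: (den_dvd_common i (a := 10)).
Qed.

Lemma int_costE (i : 'I_n) : (int_cost I i)%:~R = ratr (improvement_cost i) * D.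
Proof.
have [_ _ _ [h1 h2]] := code_fields i.
apply: scaledE; [exact: h1 | by rewrite addn1; exact: h2 |].
by rewrite -h2; exact: (den_dvd_common i (a := 12)).
Qed.

Lemma int_knapsackE : (int_knapsack I)%:~R = ratr (knapsack_budget I) * D.
Proof. by apply: scaledE => //; apply: dvdz_mulr; apply: dvdz_mulr. Qed.

Lemma int_improvementE : (int_improvement I)%:~R = ratr (improvement_budget I) * D.
Proof. by apply: scaledE => //; apply: dvdz_mulr; apply: dvdz_mull. Qed.

Lemma D_gt0 : 0 < D. Proof. by rewrite ltr0z common_den_gt0. Qed.

Lemma int_profit_ge0 i : (i < n)%N -> 0 <= int_profit I i.
Proof.
move=> hi; rewrite -(ler0z R) (int_profitE (Ordinal hi)).
by rewrite mulr_ge0 ?(ltW D_gt0) // ler0q profit_ge0.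
Qed.

Lemma int_improved_ge0 i : (i < n)%N -> 0 <= int_improved I i.
Proof.
move=> hi; rewrite -(ler0z R) (int_improvedE (Ordinal hi)).
by rewrite mulr_ge0 ?(ltW D_gt0) // ler0q improved_weight_ge0.
Qed.

Lemma int_improved_lt i : (i < n)%N -> int_improved I i < int_weight I i.
Proof.
move=> hi; rewrite -(ltr_int R) (int_improvedE (Ordinal hi)) (int_weightE (Ordinal hi)).
by rewrite ltr_pM2r ?D_gt0 // ltr_rat improved_weight_lt.
Qed.

Lemma int_cost_gt0 i : (i < n)%N -> 0 < int_cost I i.
Proof.
move=> hi; rewrite -(ltr0z R) (int_costE (Ordinal hi)).
by rewrite mulr_gt0 ?D_gt0 // ltr0q improvement_cost_gt0.
Qed.

Lemma int_knapsack_ge0 : 0 <= int_knapsack I.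
Proof. by rewrite -(ler0z R) int_knapsackE mulr_ge0 ?(ltW D_gt0) // ler0q knapsack_budget_ge0. Qed.

Lemma int_improvement_ge0 : 0 <= int_improvement I.
Proof. by rewrite -(ler0z R) int_improvementE mulr_ge0 ?(ltW D_gt0) // ler0q
  improvement_budget_ge0. Qed.
End Scaling.

Lemma digits_exist b K (f : nat -> nat) : (forall j, (j < K)%N -> (f j < b)%N) ->
  exists2 T, (T < b ^ K)%N & forall j, (j < K)%N -> ((T %/ b ^ j) %% b)%N = f j.
Proof.
elim: K f => [|K IH] f hf; first by exists 0%N.
have [T hT h] := IH (fun j => f j.+1) (fun j hj => hf j.+1 hj).
have f0 := hf 0%N (ltn0Sn K); have b0 : (0 < b)%N by lia.
exists (T * b + f 0)%N.
  by rewrite expnSr; apply: (@leq_trans (T.+1 * b)); [lia | rewrite leq_mul2r hT orbT].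
case=> [_|j hj]; first by rewrite expn0 divn1 modnMDl modn_small.
by rewrite expnS divnMA divnMDl // (divn_small f0) addn0 h.
Qed.

(** Cuts a list sorted by decreasing profit after k entries. *)
Lemma most_profitable n (p : 'I_n -> int) (x : 'I_n -> bool) k : exists s : seq 'I_n,
  [/\ uniq s, (size s <= k)%N, {subset s <= x},
      forall i j, x i -> i \notin s -> j \in s -> p i <= p j
    & forall i, x i -> i \notin s -> size s = k].
Proof.
pose e := sort (fun i j => p j <= p i) [seq i <- enum 'I_n | x i].
have ex i : (i \in e) = x i by rewrite mem_sort mem_filter mem_enum andbT.
have ue : uniq e by rewrite sort_uniq filter_uniq // enum_uniq.
have tr : transitive (fun i j => p j <= p i) by move=> a b c h1 h2; exact: le_trans h2 h1.
have se : sorted (fun i j => p j <= p i) e by apply: sort_sorted => a b; exact: le_total.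
rewrite sorted_pairwise // -[e](cat_take_drop k) pairwise_cat in se.
have /and3P[/allrelP hr _ _] := se.
have md i : x i -> i \notin take k e -> i \in drop k e.
  by rewrite -ex -{1}[e](cat_take_drop k) mem_cat => /orP[->|].
exists (take k e); split.
- exact: take_uniq.
- by rewrite size_take; case: ltnP.
- by move=> i /mem_take; rewrite ex.
- by move=> i j xi ni nj; apply: hr => //; exact: md.
- move=> i xi ni; have := md i xi ni; rewrite size_take; case: ltnP => // h.
  by rewrite drop_oversize.
Qed.

(** * Correctness of the algorithm *)

Section Correctness.
Variables (R : realType) (k : nat) (I : instance).
Local Notation n := (nitems I).
Local Notation P := (int_profit I).
Local Notation w := (int_weight I).
Local Notation v := (int_improved I).
Local Notation c := (int_cost I).
Local Notation B := (int_knapsack I).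
Local Notation C := (int_improvement I).

(** Guess the k most profitable items of (x, y). If (x, y) has no more than k items, nothing
    is lost; otherwise each of the two lost items is worth at most the average of the k
    guessed ones. *)
Lemma good_candidate (x : 'I_n -> bool) (y : 'I_n -> R) : (0 < k)%N ->
  (forall i, 0 <= y i <= (x i)%:R) ->
  \sum_(i < n) (w i)%:~R * (x i)%:R - \sum_(i < n) (w i - v i)%:~R * y i <= B%:~R ->
  \sum_(i < n) (c i)%:~R * y i <= C%:~R ->
  exists T, [/\ (T < candidates k I)%N, fits n w v c B C (picked k I T) (threshold k I T) &
    k%:Z * (\sum_(i < n) P i * (x i)%:R) <=
      k%:Z * (\sum_(i < n | picked k I T i) P i) + 2 * (\sum_(i < n) P i * (x i)%:R)].
Proof.
move=> k_gt0 hy hB hC.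
have P0 := int_profit_ge0 R (I := I); have v0 := int_improved_ge0 R (I := I).
have vw := int_improved_lt R (I := I); have c0 := int_cost_gt0 R (I := I).
have B0 := int_knapsack_ge0 R I; have C0 := int_improvement_ge0 R I.
have [s [us sk sx stop sfull]] := most_profitable (fun i : 'I_n => P i) x k.
pose f0 j : nat := nth n (map val s) j.
pose G i := has (fun j => f0 j == i) (iota 0 k).
pose S i := ~~ G i && all (fun j => (f0 j < n)%N ==> (P i <= P (f0 j))) (iota 0 k).
have Gs (i : 'I_n) : G i = (i \in s).
  apply/hasP/idP => [[j _ /eqP e]|hi].
    rewrite -(mem_map val_inj) /= -e /f0; apply: mem_nth; rewrite ltnNge; apply/negP => hj.
    by move: (ltn_ord i); rewrite -e /f0 nth_default // ltnn.
  exists (index (val i) (map val s)).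
    by rewrite mem_iota add0n (leq_trans _ sk) //= -(size_map val) index_mem mem_map //;
      exact: val_inj.
  by rewrite /f0 nth_index // mem_map //; exact: val_inj.
have f0s j : (f0 j < n)%N -> exists2 i, i \in s & f0 j = val i.
  rewrite /f0; case: (ltnP j (size (map val s))) => hj; last by rewrite nth_default ?ltnn.
  by have /mapP[i hi ->] := mem_nth n hj; exists i.
have f0_le j : (f0 j < n + 3)%N.
  rewrite /f0; case: (ltnP j (size (map val s))) => hj.
    have /mapP[i hi ->] := mem_nth n hj; exact: leq_trans (ltn_ord i) (leq_addr _ _).
  by rewrite nth_default //; lia.
have hGx (i : 'I_n) : G i -> x i by rewrite Gs => /sx.
have hxS (i : 'I_n) : x i -> G i || S i.
  move=> xi; rewrite /S; case hG : (G i) => //=; apply/allP => j _; apply/implyP => /f0s[i' hi' ->].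
  by apply: stop => //; rewrite -Gs hG.
have SG i : S i -> ~~ G i by case/andP.
have [M [M0 SM hM]] : exists M : int, [/\ 0 <= M, forall i, (i < n)%N -> S i -> P i <= M &
    k%:Z * M <= \sum_(i < n) P i * (x i)%:R \/ forall i, x i -> i \in s].
  have [hs|hs] := eqVneq (size s) k; last first.
    exists (\sum_(i < n) P i); split; first by apply: sumr_ge0 => i _; exact: P0.
      move=> i hi _; rewrite (bigD1 (Ordinal hi)) //= lerDl; apply: sumr_ge0 => j _; exact: P0.
    by right=> i xi; apply/negPn/negP => ni; case/eqP: hs; exact: sfull xi ni.
  have [i0 hi0] : exists i0, i0 \in s.
    by case: (s) hs k_gt0 => [<- //|i0 s' _ _]; exists i0; rewrite inE eqxx.
  case: (@arg_minP _ _ _ i0 (mem s) (fun i : 'I_n => P i) hi0) => j hj jmin.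
  exists (P j); split; first exact: P0.
    move=> i hi /andP[_ /allP ha].
    have := ha (index (val j) (map val s)); rewrite mem_iota add0n /=.
    have hjm : val j \in map val s by rewrite mem_map //; exact: val_inj.
    have -> : f0 (index (val j) (map val s)) = j by rewrite /f0 nth_index.
    by rewrite ltn_ord /= -hs -(size_map val) index_mem hjm => /(_ isT).
  left; apply: (@le_trans _ _ (\sum_(i in s) P i)); last first.
    rewrite big_mkcond; apply: ler_sum => i _; case: ifP => [hi|_].
      by have xi : x i := sx i hi; rewrite xi mulr1.
    by rewrite mulr_ge0 ?P0.
  apply: (@le_trans _ _ (\sum_(i in s) P j)); last by apply: ler_sum => i hi; exact: jmin.
  by rewrite sumr_const (card_uniqP us) hs -[P j *+ k]mulr_natl natz.
have [j1 [k1 [j2 [k2 [t [[hj1 hk1 hj2 hk2 ht] hfit hsum]]]]]] :=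
  rounding P0 v0 vw c0 B0 C0 SG M0 SM hy hB hC hGx hxS.
(* The digits of the candidate; a guess of fewer than k items is padded with n. *)
pose f j := if (j < k)%N then f0 j else nth 0%N [:: j1; k1; j2; k2; t] (j - k).
have [T hT hdig] : exists2 T, (T < candidates k I)%N &
    forall j, (j < k.+4.+1)%N -> digit I T j = f j.
  apply: digits_exist => j hj; rewrite /f; case: (ltnP j k) => [//|kj].
  have : (j - k < 5)%N by lia.
  by case: (j - k)%N => [|[|[|[|[|]]]]].
have dk r : (r < 5)%N -> digit I T (k + r) = nth 0%N [:: j1; k1; j2; k2; t] r.
  by move=> hr; rewrite hdig /f; [rewrite ltnNge leq_addr addKn | lia].
have dg i : guessed k I T i = G i.
  apply: eq_in_has => j; rewrite mem_iota add0n /= => hj; rewrite hdig /f ?hj //; lia.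
have dS i : eligible k I T i = S i.
  rewrite /eligible /S dg; congr andb; apply: eq_in_all => j; rewrite mem_iota add0n /= => hj.
  by rewrite hdig /f ?hj //; lia.
have d0 := dk 0%N isT; have d1 := dk 1%N isT; have d2 := dk 2%N isT.
have d3 := dk 3%N isT; have d4 := dk 4%N isT.
rewrite addn0 in d0; rewrite addn1 in d1; rewrite addn2 in d2.
rewrite addn3 in d3; rewrite addn4 in d4.
have dp : picked k I T = (fun i => G i || S i && profitable n P w v c (j1, k1) (j2, k2) i).
  by apply: funext => i; rewrite /picked dg dS d0 d1 d2 d3.
exists T; split => //; first by rewrite dp /threshold d4.
rewrite dp; case: hM => [hM|hM].
  set a := \sum_(i < n) P i * (x i)%:R in hM hsum *.
  set b := \sum_(i < n | _) P i in hsum *; nia.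
have Pge (i : 'I_n) := P0 i (ltn_ord i).
have le1 : \sum_(i < n) P i * (x i)%:R <= \sum_(i < n | G i || S i && profitable n P w v c (j1,
  k1) (j2, k2) i) P i.
  rewrite [X in _ <= X]big_mkcond; apply: ler_sum => i _.
  case xi: (x i); last by rewrite mulr0; case: ifP.
  by rewrite mulr1 Gs hM.
have a0 : 0 <= \sum_(i < n) P i * (x i)%:R by apply: sumr_ge0 => i _; rewrite mulr_ge0.
set a := \sum_(i < n) P i * (x i)%:R in le1 a0 *.
set b := \sum_(i < n | _) P i in le1 *; nia.
Qed.

Lemma best_fits_and_dominates T : (T < candidates k I)%N ->
  fits n w v c B C (picked k I T) (threshold k I T) ->
  let b := best k I in
  fits n w v c B C (picked k I b) (threshold k I b) /\
  \sum_(i < n | picked k I T i) P i <= \sum_(i < n | picked k I b i) P i.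
Proof.
move=> hT hfit b.
have hb : forall U, (U < candidates k I)%N -> value k I U <= value k I b.
  pose p T := ~~ has (fun U => value k I T < value k I U) (iota 0 (candidates k I)).
  have hp : has p (iota 0 (candidates k I)).
    case: (@arg_maxP _ _ _ (Ordinal hT) predT (fun U : 'I_(candidates k I) => value k I U) isT)
      => U _ hU.
    apply/hasP; exists (val U); first by rewrite mem_iota /=.
    apply/hasPn => V; rewrite mem_iota add0n /= => hV; rewrite -leNgt.
    exact: (hU (Ordinal hV)).
  have := nth_find 0%N hp; rewrite nth_iota; last by rewrite has_find size_iota in hp.
  rewrite add0n -/b => /hasPn h U hU; rewrite leNgt; apply: h.
  by rewrite mem_iota.
have Pge (i : 'I_n) := int_profit_ge0 R (ltn_ord i).
have := hb T hT; rewrite /value hfit.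
have h0 : 0 <= \sum_(i < n | picked k I T i) P i by apply: sumr_ge0 => i _.
by case: ifP => // _; lia.
Qed.

Lemma fits_feasible (X : pred nat) t : fits n w v c B C X t ->
  feasible (R := R) (fun i : 'I_n => X i)
    (fun i => (y_num n w v c C X t i)%:~R / (y_den n w v c X t)%:~R).
Proof.
move=> /and3P[cut0 hC hB]; have D0 := D_gt0 R I; have q0 := y_den_gt0 n w v c X t.
set q := y_den _ _ _ _ _ _ in hC hB q0 *; have qR : 0 < q%:~R :> R by rewrite ltr0z.
split.
- rewrite -(ler_pM2r D0) -int_knapsackE -(ler_pM2r qR).
  move: hB; rewrite -(ler_int R) intrB (intrM R q) (intrM R B q) !rmorph_sum /=; apply: le_trans.
  rewrite le_eqVlt; apply/orP; left; apply/eqP.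
  rewrite !mulrBl; congr (_ - _).
    rewrite [X in _ = _ * X]big_mkcond /= mulrC; congr (_ * _); rewrite mulr_suml.
    by apply: eq_bigr => i _; rewrite int_weightE; case: (X i); rewrite ?mulr1 ?mulr0 ?mul0r.
  rewrite !mulr_suml; apply: eq_bigr => i _.
  rewrite (intrM R (w i - v i)) intrB int_weightE int_improvedE /weight_reduction rmorphB /=.
  by field; rewrite gt_eqF.
- rewrite -(ler_pM2r D0) -int_improvementE -(ler_pM2r qR).
  move: hC; rewrite -(ler_int R) (intrM R C q) !rmorph_sum /=; apply: le_trans.
  rewrite le_eqVlt; apply/orP; left; apply/eqP.
  rewrite !mulr_suml; apply: eq_bigr => i _; rewrite (intrM R (c i)) int_costE.
  by field; rewrite gt_eqF.
- move=> i; rewrite /y_num; have cutq : y_cut n w v c C X t <= q by rewrite /y_cut ge_min lexx.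
  rewrite divr_ge0 ?(ltW qR) ?ler_pdivrMr //=; last first.
    by rewrite ler0z; do ! case: ifP => _ //; exact: ltW.
  case: (X i) => /=; last by rewrite mul0r.
  by rewrite mul1r ler_int; do ! case: ifP => _ //; exact: ltW.
Qed.

Lemma feasible_scaled (x : 'I_n -> bool) (y : 'I_n -> R) : feasible x y ->
  [/\ forall i, 0 <= y i <= (x i)%:R,
      \sum_(i < n) (w i)%:~R * (x i)%:R - \sum_(i < n) (w i - v i)%:~R * y i <= B%:~R
    & \sum_(i < n) (c i)%:~R * y i <= C%:~R].
Proof.
move=> [hB hC hy]; have D0 := D_gt0 R I; split=> //.
- rewrite int_knapsackE; apply: le_trans (ler_wpM2r (ltW D0) hB).
  rewrite le_eqVlt; apply/orP; left; apply/eqP; rewrite mulrBl !mulr_suml.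
  congr (_ - _); apply: eq_bigr => i _; rewrite ?intrB int_weightE ?int_improvedE; last first.
    by rewrite /weight_reduction rmorphB /=; ring.
  by ring.
- rewrite int_improvementE; apply: le_trans (ler_wpM2r (ltW D0) hC).
  rewrite le_eqVlt; apply/orP; left; apply/eqP; rewrite mulr_suml.
  by apply: eq_bigr => i _; rewrite int_costE; ring.
Qed.

Lemma objective_scaled (x : 'I_n -> bool) :
  (\sum_(i < n) P i * (x i)%:R)%:~R = objective R x * (common_den I)%:~R.
Proof.
rewrite rmorph_sum /objective mulr_suml; apply: eq_bigr => i _ /=.
by rewrite (intrM R (P i)) int_profitE; case: (x i); rewrite ?mulr1 ?mulr0 ?mul0r.
Qed.
End Correctness.

(** There are finitely many x, so the maximum is attained although y is real. *)
Lemma optimal_value_exists (R : realType) (I : instance) :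
  exists (x : 'I_(nitems I) -> bool) (y : 'I_(nitems I) -> R),
    feasible x y /\ is_optimal_value I (objective R x).
Proof.
pose ok (x : {ffun 'I_(nitems I) -> bool}) := `[< exists y : 'I_(nitems I) -> R, feasible x y >].
have ok0 : ok [ffun=> false].
  apply/asboolP; exists (fun=> 0); split.
  - rewrite big1 ?big1 ?subrr ?ler0q ?knapsack_budget_ge0 // => i _; rewrite ?mulr0 //.
    by rewrite ffunE mulr0.
  - by rewrite big1 ?ler0q ?improvement_budget_ge0 // => i _; rewrite mulr0.
  - by move=> i; rewrite ffunE lexx.
case: (@arg_maxP _ _ _ [ffun=> false] ok (fun x => objective R x) ok0) => x /asboolP[y hy] hmax.
exists x, y; split=> //; split; first by exists x, y.
move=> x' y' h'.
have e : ([ffun i => x' i] : 'I_(nitems I) -> bool) = x' by apply: funext => i; rewrite ffunE.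
by have := hmax [ffun i => x' i]; rewrite /= e; apply; apply/asboolP; exists y'; rewrite e.
Qed.

(** * The approximation scheme *)

Lemma output_register n i r : (i < n)%N -> (r < 3)%N ->
  [/\ (3 * i + r < 3 * n)%N, ((3 * i + r) %/ 3 = i)%N & ((3 * i + r) %% 3 = r)%N].
Proof. by move=> *; split; lia. Qed.

Unset Implicit Arguments.
Set Strict Implicit.

Theorem theorem3p7 (R : realType) (eps : R) (heps : 0 < eps < 1) :
  exists (prog : program) (c d : nat),
    forall I : instance,
      exists (m : memory) (t : nat),
        exec prog (initial_memory I) m t /\
        (t <= c * input_size I ^ d)%N /\
        exists (x : 'I_(nitems I) -> bool) (y : 'I_(nitems I) -> R) (opt : R),
          [/\ outputs m x y,
              feasible x y,
              is_optimal_value I opt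
            & objective R x >= (1 - eps) * opt].
Proof.
have /andP[e0 e1] := heps.
(* Two lost items, each worth at most OPT / k, must not exceed eps OPT. *)
set k := Num.bound (2 / eps).
have hk : 2 <= k%:R * eps.
  by rewrite -ler_pdivrMr //; apply/ltW/archi_boundP; rewrite divr_ge0 // ltW.
have k0 : (0 < k)%N.
  by rewrite lt0n; apply/negP => /eqP k0; move: hk; rewrite k0 mul0r; lra.
have [prog [c [d hprog]]] := output_program (computable_answer k).
exists prog, c, d => I; have [m [t [hexec ht hm]]] := hprog I.
exists m, t; split=> //; split=> //.
have [x0 [y0 [hf hopt]]] := optimal_value_exists R I.
have [hy hB hC] := feasible_scaled hf.
have [T [hT hfit hval]] := good_candidate k0 hy hB hC.
have [hbfit hbest] := best_fits_and_dominates R hT hfit.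
set b := best k I in hbfit hbest.
exists (fun i => picked k I b i), (fun i =>
  (y_num (nitems I) (int_weight I) (int_improved I) (int_cost I) (int_improvement I)
     (picked k I b) (threshold k I b) i)%:~R
  / (y_den (nitems I) (int_weight I) (int_improved I) (int_cost I)
     (picked k I b) (threshold k I b))%:~R), (objective R x0).
split=> //.
- move=> i; have reg r := @output_register _ _ r (ltn_ord i).
  have [l0 q0 r0] := reg 0%N isT; have [l1 q1 r1] := reg 1%N isT; have [l2 q2 r2] := reg 2%N isT.
  rewrite addn0 in l0 q0 r0.
  rewrite (hm _ l0) (hm _ l1) (hm _ l2) /answer q0 r0 q1 r1 q2 r2 /=.
  by split; [case: (picked _ _ _ _) | exact: y_den_gt0 |].
- exact: fits_feasible.
have D0 := D_gt0 R I.
have hb : \sum_(i < nitems I | picked k I b i) int_profit I i =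
    \sum_(i < nitems I) int_profit I i * (picked k I b i)%:R.
  by rewrite big_mkcond; apply: eq_bigr => i _; case: (picked _ _ _ _); rewrite ?mulr1 ?mulr0.
rewrite hb in hbest.
have obj0 : 0 <= objective R x0.
  by apply: sumr_ge0 => i _; rewrite mulr_ge0 ?ler0q ?profit_ge0.
have key : k%:R * objective R x0 <= k%:R * @objective R I (fun i => picked k I b i) + 2 *
  objective R x0.
  rewrite -(ler_pM2r D0) mulrDl -!mulrA -!objective_scaled.
  set a := \sum_(i < _) _ in hval *; set a' := \sum_(i < _) _ in hbest *.
  have h : k%:Z * a <= k%:Z * a' + 2 * a.
    by apply: le_trans hval _; rewrite lerD2r ler_wpM2l.
  by move: h; rewrite -(ler_int R) intrD !intrM -!pmulrn.
have kR : 0 < k%:R :> R by rewrite ltr0n.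
rewrite -(ler_pM2l kR); nra.
Qed.
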